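(* Let $\nu\in\mathcal M_2(\Omega_d)$ be a L\'evy measure with finite second moments and equal marginals ${\pi_i}_\#\nu=\overline\nu$ for $i=1,\dots,d$. Denote by $\nu^+=\Sigma_\#\nu\in\mathcal M_2(\Omega_1)$, where $\Sigma(\mathbf s)=\sum_{i=1}^d s_i$. Then $$\mathcal W_*(\nu,\nu^{\mathrm{co}})^2=2d\,M_2(\overline\nu)-2\int_0^{+\infty}U_{\nu^+}^{-1}(s)\,U_{\overline\nu}^{-1}(s)\,ds,$$ where $M_2(\overline\nu)=\int_{\Omega_1}s^2\,d\overline\nu(s)$. Moreover, when $\nu=\nu^\perp$, $$\mathcal W_*(\nu^\perp,\nu^{\mathrm{co}})^2=2d\Big(M_2(\overline\nu)-\int_0^{+\infty}s\,U_{\overline\nu}^{-1}\big(d\,U_{\overline\nu}(s)\big)\,d\overline\nu(s)\Big).$$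
   Context: $\Omega_d=[0,+\infty)^d\setminus\{\mathbf 0\}$, so $\Omega_1=(0,+\infty)$. $\mathcal M_2(\Omega_d)$ is the set of positive Borel measures $\nu$ on $\Omega_d$ (possibly of infinite mass) with $\int_{\Omega_d}\|\mathbf s\|^2d\nu(\mathbf s)<+\infty$; every element of $\mathcal M_2(\Omega_d)$ counts as a L\'evy measure here. $f_\#\mu$ denotes the pushforward of $\mu$ by $f$. For measures on $\Omega_d$, ${\pi_i}_\#\nu$ is the pushforward by the $i$-th coordinate map, regarded as a measure on $\Omega_1$ (that is, restricted to $\Omega_1$). Given $\overline\nu\in\mathcal M_2(\Omega_1)$: $\nu^{\mathrm{co}}$ is the pushforward of $\overline\nu$ by $s\mapsto(s,\dots,s)\in\Omega_d$ (concentrated on the bisecting line), and $\nu^\perp=\sum_{j=1}^d (s\mapsto s\,e_j)_\#\overline\nu$, with $e_j$ the $j$-th standard basis vector (concentrated on the axes). For $\mu\in\mathcal M_2(\Omega_1)$ the tail integral is $U_\mu(x)=\mu((x,+\infty))$, $x\ge0$ (with $U_\mu(0)=\mu(\Omega_1)\in[0,+\infty]$), and its generalized inverse is $U_\mu^{-1}(t)=\inf\{x\ge0: U_\mu(x)\le t\}$. Extended Wasserstein distance: for $\nu^1,\nu^2\in\mathcal M_2(\Omega_d)$ let $\overline\Gamma(\nu^1,\nu^2)$ be the set of $\gamma\in\mathcal M_2(\Omega_{2d})$ such that the pushforwards of $\gamma$ by $(\mathbf s,\mathbf s')\mapsto\mathbf s$ and $(\mathbf s,\mathbf s')\mapsto\mathbf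 s'$ (with $\mathbf s,\mathbf s'\in[0,+\infty)^d$), restricted to $\Omega_d$, equal $\nu^1$ and $\nu^2$ respectively. Then $\mathcal W_*(\nu^1,\nu^2)^2=\inf_{\gamma\in\overline\Gamma(\nu^1,\nu^2)}\iint_{\Omega_{2d}}\|\mathbf s-\mathbf s'\|^2\,d\gamma(\mathbf s,\mathbf s')$.
   Formalization: The ''moreover'' formula is proved only when $\overline\nu$ has no atoms; as stated it is false with atoms: for $d=2$, $\overline\nu=\delta_1$ the right side is 0 but $\mathcal W_*(\nu^\perp,\nu^{\mathrm{co}})^2=2$. *)

(* Defs.v *)
From HB Require Import structures.
From mathcomp Require Import all_boot all_order all_algebra.
From mathcomp Require Import all_classical all_reals all_analysis.

Import Order.TTheory GRing.Theory Num.Theory.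
Import numFieldNormedType.Exports.

Local Open Scope classical_set_scope.
Local Open Scope ring_scope.
Local Open Scope ereal_scope.

(* Vectors of R^d are d-tuples, whose sigma-algebra is generated by the
   coordinate maps, i.e. is the Borel one; R^2d is R^d * R^d with the product
   sigma-algebra. A measure on a Borel subset O of such a space is encoded as
   a measure on the whole space for which the complement of O is null. *)

Section levy_measures.
Context {R : realType}.

Definition orthant (d : nat) : set (d.-tuple R) :=
  [set s | forall i, (0 <= tnth s i)%R].

Definition origin (d : nat) : d.-tuple R := [tuple 0%R | i < d].

Definition Omega (d : nat) : set (d.-tuple R) := orthant d `\ origin d.

Definition Omega1 : set R := `]0%R, +oo[.

Definition Omega2 (d : nat) : set (d.-tuple R * d.-tuple R) :=
  (orthant d `*` orthant d) `\ (origin d, origin d).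

Definition sqnorm {d : nat} (s : d.-tuple R) : R :=
  (\sum_(i < d) tnth s i ^+ 2)%R.

Definition sqnorm2 {d : nat} (p : d.-tuple R * d.-tuple R) : R :=
  (sqnorm p.1 + sqnorm p.2)%R.

Definition sqdist {d : nat} (p : d.-tuple R * d.-tuple R) : R :=
  (\sum_(i < d) (tnth p.1 i - tnth p.2 i) ^+ 2)%R.

(* [q] is the squared Euclidean norm of the ambient space of [O]. *)
Definition in_M2 {disp : measure_display} {T : measurableType disp}
    (O : set T) (q : T -> R) (mu : set T -> \bar R) : Prop :=
  mu (~` O) = 0 /\ \int[mu]_(x in O) (q x)%:E < +oo.

Definition M2_Omega {d : nat} (nu : set (d.-tuple R) -> \bar R) : Prop :=
  in_M2 (Omega d) (sqnorm) nu.

Definition M2_Omega1 (mu : set R -> \bar R) : Prop :=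
  in_M2 Omega1 (fun s => s ^+ 2)%R mu.

Definition M2_Omega2 {d : nat}
    (gamma : set (d.-tuple R * d.-tuple R) -> \bar R) : Prop :=
  in_M2 (Omega2 d) (sqnorm2) gamma.

Definition eq_on {disp : measure_display} {T : measurableType disp}
    (O : set T) (mu mu' : set T -> \bar R) : Prop :=
  forall A, measurable A -> A `<=` O -> mu A = mu' A.

Definition second_moment (mu : set R -> \bar R) : \bar R :=
  \int[mu]_(s in Omega1) (s ^+ 2)%:E.

Definition nu_co (d : nat) (mu : set R -> \bar R) :
    set (d.-tuple R) -> \bar R :=
  pushforward mu (fun s : R => [tuple s | i < d]).

Definition nu_perp (d : nat) (mu : set R -> \bar R) :
    set (d.-tuple R) -> \bar R :=
  fun A => \sum_(j < d)
    pushforward mu (fun s : R => [tuple (if i == j then s else 0%R) | i < d]) A.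

Definition nu_plus {d : nat} (nu : set (d.-tuple R) -> \bar R) :
    set R -> \bar R :=
  pushforward nu (fun s : d.-tuple R => \sum_(i < d) tnth s i)%R.

Definition tail (mu : set R -> \bar R) (x : R) : \bar R :=
  mu `]x, +oo[%classic.

(* The infimum of the empty set is +oo. *)
Definition tail_inv (mu : set R -> \bar R) (t : \bar R) : \bar R :=
  ereal_inf [set x%:E | x in [set x : R | (0 <= x)%R /\ tail mu x <= t]].

(* The marginals are compared on [Omega d] only: the mass that [gamma] sends
   to the origin of either factor is unconstrained. *)
Definition extended_couplings {d : nat} (nu1 nu2 : set (d.-tuple R) -> \bar R) :
    set {measure set (d.-tuple R * d.-tuple R)%type -> \bar R} :=
  [set gamma | [/\ M2_Omega2 gamma,
    eq_on (Omega d) (pushforward gamma fst) nu1 &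
    eq_on (Omega d) (pushforward gamma snd) nu2]].

Definition wasserstein {d : nat} (nu1 nu2 : set (d.-tuple R) -> \bar R) :
    \bar R :=
  sqrte (ereal_inf [set \int[gamma]_(p in Omega2 d) (sqdist p)%:E
                   | gamma in extended_couplings nu1 nu2]).

End levy_measures.

(* Main.v *)
(* A coupling gamma of nu and nu^co charges only pairs (s, (r, ..., r)), and
   there |s - s'|^2 + 2 (Sigma s) r = |s|^2 + |s'|^2.  The right-hand side has
   integral 2 d M_2(nubar) for every coupling, so one has to maximise the
   integral of (Sigma s) r.  By the layer-cake formula this is the integral of
   gamma(Sigma s > x, r > y) over x, y > 0, hence at most the integral of
   min(U_{nu+}(x), U_nubar(y)), which is also the integral of the product of
   the two generalised inverses.
   The bound is attained without disintegrating nu: on nu x Lebesgue[0, 1] put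
   V(s, u) = U_{nu+}(Sigma s) + u nu+({Sigma s}), whose law is Lebesgue measure
   on (0, mass of nu), and take r = U_nubar^{-1}(V).  No mass has to be taken
   from the origin, because nu has at least the mass of nubar.
   For nu^perp one has nu+ = d nubar, and when nubar has no atoms V does not
   depend on u, which turns the optimal value into an integral against nubar. *)

(* The measures may have infinite mass near the origin, so they cannot be normalised to probability
   laws. Markov's inequality for the second moment takes over: it makes them sigma-finite, so that
   Tonelli applies, and makes tails finite at positive levels and vanishing at infinity. Laws are
   therefore compared on rays []y, +oo[] with [0 < y]. The hinge is the Galois relation:
   [x < U^{-1}(t)] iff [t < U(x)]. It turns superlevel sets of the inverses into intervals, so that
   the integral of their product, the upper bound and its attainment all become one double integral
   of a minimum of two tails. The cost and the cross term are kept as a sum until finiteness permits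
   a subtraction in the extended reals. *)
Require Import Defs.
From HB Require Import structures.
From mathcomp Require Import all_boot all_order all_algebra.
From mathcomp Require Import all_classical all_reals all_analysis.
From mathcomp Require Import measurable_realfun.
From mathcomp Require Import ring lra.

Import Order.TTheory GRing.Theory Num.Theory.
Import numFieldNormedType.Exports.

Local Open Scope classical_set_scope.
Local Open Scope ring_scope.
Local Open Scope ereal_scope.

(** * The layer-cake formula *)

Section layer_cake.
Context {R : realType}.

Lemma lebesgue_itv0 (a : \bar R) : 0 <= a ->
  lebesgue_measure [set y : R | (0 < y)%R /\ y%:E < a] = a.
Proof.
case: a => [r| |] //.
- rewrite lee_fin => r0.
  rewrite [X in lebesgue_measure X](_ : _ = `]0%R, r[%classic); last first.
    by apply/seteqP; split => y /=; rewrite in_itv/= lte_fin;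
      [case=> -> ->|move/andP].
  rewrite lebesgue_measure_itv/= lte_fin sube0.
  by case: ltP => // r1; congr EFin; apply/le_anti/andP.
- move=> _; rewrite [X in lebesgue_measure X](_ : _ = `]0%R, +oo[%classic).
    by rewrite lebesgue_measure_itv/= ltry.
  by apply/seteqP; split => y /=; rewrite in_itv/= ltry andbT; [case|].
Qed.

Lemma lebesgue_unit_itv : lebesgue_measure `[0%R, 1%R : R]%classic = 1.
Proof. by rewrite lebesgue_measure_itv/= lte_fin ltr01 sube0. Qed.

(** Tonelli on the region [0 < y < f x]. The weight [h] allows the formula to be applied twice, once
    for each factor of a product. *)
Lemma layer_cake_weight {d} {T : measurableType d}
    (mu : {measure set T -> \bar R}) (f h : T -> \bar R) :
  sigma_finite setT mu ->
  measurable_fun setT f -> measurable_fun setT h ->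
  (forall x, 0 <= f x) -> (forall x, 0 <= h x) ->
  \int[mu]_x (h x * f x) =
  \int[lebesgue_measure]_(y in `]0%R, +oo[)
    \int[mu]_(x in [set x | y%:E < f x]) h x.
Proof.
move=> smu mf mh f0 h0.
(* [sigma_finite] is only a proposition here; the measure is repackaged with the structure that
   Tonelli's theorem asks for. *)
pose S1 := isSFinite.Build _ _ _ mu (sfinite_measure_sigma_finite smu).
pose S2 := isSigmaFinite.Build _ _ _ mu smu.
pose mu' := HB.pack_for {sigma_finite_measure set T -> \bar R}
  (Measure.sort mu) S1 S2.
have -> : mu = mu' :> {measure set T -> \bar R}.
  exact: eq_measure.
pose E := [set p : T * R | (0 < p.2)%R /\ p.2%:E < f p.1].
have mE : measurable E.
  rewrite (_ : E = (setT `&` [set p | 0 < p.2%:E]) `&`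
                   (setT `&` [set p | p.2%:E < f p.1])); last first.
    by rewrite !setTI; apply/seteqP; split => p /=; rewrite /E/= lte_fin.
  apply: measurableI; apply: measurable_lte => //.
  - exact/measurable_EFinP.
  - exact/measurable_EFinP.
  - exact: measurableT_comp.
pose k := fun p : T * R => h p.1 * (\1_E p)%:E.
have mk : measurable_fun setT k.
  apply: emeasurable_funM; first exact: measurableT_comp.
  exact/measurable_EFinP/measurable_indic.
have k0 p : 0 <= k p by rewrite mule_ge0// lee_fin.
transitivity (\int[mu']_x \int[lebesgue_measure]_y k (x, y)).
  apply: eq_integral => x _; rewrite /k/=.
  have mEx : measurable [set y : R | (0 < y)%R /\ y%:E < f x].
    rewrite (_ : mkset _ = xsection E x); first exact: measurable_xsection.
    by apply/seteqP; split => y; rewrite /xsection/= inE.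
  rewrite ge0_integralZl//.
  - rewrite -[in LHS](lebesgue_itv0 _ (f0 x)) -[in LHS](setIT (mkset _)).
    by rewrite -integral_indic.
  apply/measurable_EFinP.
  rewrite (_ : (fun _ => _) = \1_[set y : R | (0 < y)%R /\ y%:E < f x]) //.
rewrite -fubini_tonelli1// fubini_tonelli2// [RHS]integral_mkcond.
apply: eq_integral => y _; rewrite patchE /fubini_G /k.
case: ifPn => y0; last first.
  apply: integral0_eq => x _; rewrite indicE memNset ?mule0//= /E/= => -[yy _].
  by move: y0; rewrite notin_setE/= in_itv/= andbT; exact.
move: y0; rewrite inE/= in_itv/= andbT => y0.
rewrite [RHS]integral_mkcond; apply: eq_integral => x _.
rewrite patchE indicE; case: ifPn => [/set_mem/= yf|].
  by rewrite mem_set ?mule1.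
by rewrite notin_setE/= => yf; rewrite memNset ?mule0// => -[].
Qed.

Lemma layer_cake {d} {T : measurableType d}
    (mu : {measure set T -> \bar R}) (D : set T) (f g : T -> \bar R) :
  sigma_finite setT mu -> measurable D ->
  measurable_fun D f -> measurable_fun D g ->
  (forall x, D x -> 0 <= f x) -> (forall x, D x -> 0 <= g x) ->
  \int[mu]_(x in D) (f x * g x) =
  \int[lebesgue_measure]_(y in `]0%R, +oo[)
    \int[lebesgue_measure]_(x in `]0%R, +oo[)
      mu (D `&` [set t | x%:E < f t /\ y%:E < g t]).
Proof.
move=> smu mD mf mg f0 g0.
have mfD : measurable_fun setT (f \_ D) by apply/(measurable_restrictT _ mD).
have mgD : measurable_fun setT (g \_ D) by apply/(measurable_restrictT _ mD).
have fD0 x : 0 <= (f \_ D) x.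
  by rewrite patchE; case: ifPn => // /set_mem /f0.
have gD0 x : 0 <= (g \_ D) x.
  by rewrite patchE; case: ifPn => // /set_mem /g0.
transitivity (\int[mu]_x ((f \_ D) x * (g \_ D) x)).
  rewrite integral_mkcond; apply: eq_integral => x _; rewrite !patchE.
  by case: ifPn => //; rewrite mule0.
pose above (h : T -> \bar R) (z : R) := [set t | z%:E < (h \_ D) t].
have mabove h z : measurable_fun setT (h \_ D) -> measurable (above h z).
  by move=> mh; rewrite -[X in measurable X]setTI; apply: measurable_lte.
(* First [g] is sliced with weight [f]; below, [f] is sliced with weight the indicator of
   [y < g]. *)
rewrite layer_cake_weight//; apply: eq_integral => y /set_mem.
rewrite /= in_itv/= andbT => y0.
transitivity (\int[mu]_t ((\1_(above g y) t)%:E * (f \_ D) t)).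
  rewrite integral_mkcond; apply: eq_integral => x _.
  rewrite patchE indicE; case: ifPn => _; first by rewrite mul1e.
  by rewrite mul0e.
rewrite layer_cake_weight//; last first.
  by apply/measurable_EFinP; apply: measurable_indic; exact: mabove.
apply: eq_integral => x /set_mem; rewrite /= in_itv/= andbT => x0.
rewrite integral_indic; [|exact: (mabove f)|exact: mabove].
congr (mu _); apply/seteqP; split => t; rewrite /above/=.
  rewrite !patchE; case: ifPn => [/set_mem Dt []//|_].
  by rewrite lte_fin ltNge (ltW y0) => -[].
by move=> [Dt [xf yg]]; rewrite !patchE !mem_set.
Qed.

End layer_cake.

(** * Finite second moments: Markov's inequality and sigma-finiteness *)

Section in_M2_theory.
Context {R : realType} {disp : measure_display} {T : measurableType disp}.
Variables (O : set T) (q : T -> R) (mu : {measure set T -> \bar R}).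
Hypotheses (mO : measurable O) (mq : measurable_fun O q).
Hypotheses (q_gt0 : forall x, O x -> (0 < q x)%R) (M2mu : in_M2 O q mu).

Lemma measurable_in_M2 (c : R) : measurable (O `&` [set x | (c <= q x)%R]).
Proof.
have := @measurable_fun_ler _ _ _ O (cst c) q (@measurable_cst _ _ _ _ O c) mq.
move=> /(_ mO [set true] Logic.I).
by congr (measurable (_ `&` _)); apply/seteqP; split => x /=.
Qed.

Lemma in_M2_markov (c : R) : (0 < c)%R ->
  c%:E * mu (O `&` [set x | (c <= q x)%R]) <= \int[mu]_(x in O) (q x)%:E.
Proof.
move=> c0; have /measurable_EFinP mq' := mq.
have := le_integral_abse mu mO mq' c0.
rewrite (_ : O `&` _ = O `&` [set x | (c <= q x)%R]); last first.
  apply/seteqP; split => x /= [Ox]; have /ltW q0 := q_gt0 _ Ox.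
    by rewrite lee_fin ger0_norm.
  by rewrite lee_fin ger0_norm.
move/le_trans; apply; rewrite le_eqVlt; apply/orP; left; apply/eqP.
by apply: eq_integral => x /set_mem Ox /=; rewrite ger0_norm// ltW ?q_gt0.
Qed.

Lemma in_M2_lty (c : R) : (0 < c)%R ->
  mu (O `&` [set x | (c <= q x)%R]) < +oo.
Proof.
move=> c0; have := in_M2_markov _ c0; apply: contraTT.
rewrite -leNgt -ltNge leye_eq => /eqP ->.
by rewrite gt0_muley ?lte_fin//; case: M2mu.
Qed.

(** Since [q] is positive on [O], the sets where it is at least [1 / (n + 1)], of finite mass by
    Markov, exhaust [O]. The null complement of [O] is added to cover the whole space. *)
Lemma in_M2_sigma_finite : sigma_finite setT mu.
Proof.
exists (fun n => ~` O `|` (O `&` [set x | (n.+1%:R^-1 <= q x)%R])).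
  apply/esym; rewrite -subTset => x _.
  have [Ox|nOx] := pselect (O x); last by exists 0%N => //; left.
  have [n] := @ltr_add_invr R 0 (q x) (q_gt0 _ Ox); rewrite add0r => nq.
  by exists n => //; right; split => //; exact: ltW.
move=> n.
have mA := measurable_in_M2 n.+1%:R^-1.
split; first by apply: measurableU => //; exact: measurableC.
rewrite (le_lt_trans (measureU2 _ _ _))//; first exact: measurableC.
by case: M2mu => M2C _; rewrite [X in X + _]M2C add0e in_M2_lty// invr_gt0.
Qed.

End in_M2_theory.

(** * Tail integrals and their generalised inverses *)

Section tail_theory.
Context {R : realType}.
Implicit Types P : {measure set R -> \bar R}.

Lemma le_tail P (x y : R) : (x <= y)%R -> tail P y <= tail P x.
Proof.
move=> xy; rewrite /tail le_measure ?inE//.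
by move=> z /=; rewrite !in_itv/= !andbT; exact: le_lt_trans.
Qed.

Lemma tail_ge0 P x : 0 <= tail P x. Proof. exact: measure_ge0. Qed.

(** Continuity from below along the rays []x + 1 / (n + 1), +oo[], valid also when [tail P x] is
    infinite. *)
Lemma tail_right_continuous P (x : R) (t : \bar R) : t < tail P x ->
  exists2 y, (x < y)%R & t < tail P y.
Proof.
pose F n : set R := `](x + n.+1%:R^-1)%R, +oo[%classic.
have UF : \bigcup_n F n = `]x, +oo[%classic.
  apply/seteqP; split => [z [n _]|z]; rewrite /F/= !in_itv/= !andbT.
    by apply: le_lt_trans; rewrite lerDl.
  move=> /ltr_add_invr[n xz].
  by exists n => //; rewrite /F/= in_itv/= andbT.
have cvF : P \o F @ \oo --> tail P x.
  rewrite /tail -UF; apply: nondecreasing_cvg_mu => //.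
  - by move=> i; exact: measurable_itv.
  - by rewrite UF; exact: measurable_itv.
  move=> m n mn; apply/subsetPset => z; rewrite /F/= !in_itv/= !andbT.
  by apply: le_lt_trans; rewrite lerD2l lef_pV2 ?posrE// ler_nat.
move=> tx.
have [n _ /(_ n (leqnn n))/= tn] : \forall n \near \oo, t < (P \o F) n.
  exact: (cvF _ (open_ereal_gt' tx)).
by exists (x + n.+1%:R^-1)%R => //; rewrite ltrDl.
Qed.

Lemma tail_inv_ge0 P t : 0 <= tail_inv P t.
Proof. by apply: le_ereal_inf_tmp => _ [x [x0 _] <-]; rewrite lee_fin. Qed.

(** Right continuity of the tail is what makes the inequality strict on both sides of this Galois
    relation. *)
Lemma lt_tail_inv P (x : R) (t : \bar R) : (0 <= x)%R ->
  (x%:E < tail_inv P t) = (t < tail P x).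
Proof.
move=> x0; apply/idP/idP.
  apply: contraTT; rewrite -!leNgt => Px.
  by apply: ereal_inf_lbound; exists x.
move=> /tail_right_continuous[y xy ty].
rewrite (@lt_le_trans _ _ y%:E) ?lte_fin//.
apply: le_ereal_inf_tmp => _ [z [z0 Pz] <-]; rewrite lee_fin leNgt.
apply/negP => /ltW /(le_tail P) Pyz.
by have := lt_le_trans ty (le_trans Pyz Pz); rewrite ltxx.
Qed.

Lemma tail_inv_le P (x : R) (t : \bar R) : (0 <= x)%R ->
  (tail_inv P t <= x%:E) = (tail P x <= t).
Proof. by move=> x0; rewrite !leNgt lt_tail_inv. Qed.

Lemma le_tail_inv P (t u : \bar R) : t <= u -> tail_inv P u <= tail_inv P t.
Proof.
move=> tu; apply: ereal_inf_le_tmp => _ [x [x0 Px] <-].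
by exists x => //; split => //; exact: le_trans tu.
Qed.

Lemma nonincreasing_emeasurable (f : R -> \bar R) :
  {homo f : x y / (x <= y)%R >-> y <= x} -> measurable_fun setT f.
Proof.
move=> f_ni.
apply: (measurability _ (ErealGenOInfty.measurableE R)) => // _ [_ [r ->] <-].
rewrite setTI; apply: is_interval_measurable => x y /=.
rewrite !in_itv/= !andbT => rx ry z /andP[_ /f_ni fyz].
by rewrite in_itv/= andbT; exact: lt_le_trans ry fyz.
Qed.

Lemma measurable_tail P : measurable_fun setT (tail P).
Proof. by apply: nonincreasing_emeasurable => x y; exact: le_tail. Qed.

Lemma measurable_tail_inv P :
  measurable_fun setT (fun t : R => tail_inv P t%:E).
Proof.
by apply: nonincreasing_emeasurable => x y xy; rewrite le_tail_inv ?lee_fin.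
Qed.

Lemma measurable_Omega1 : measurable (@Omega1 R).
Proof. exact: measurable_itv. Qed.

Let measurable_sqr D : measurable_fun D (fun s : R => s ^+ 2)%R.
Proof. exact: exprn_measurable. Qed.

Let sqr_gt0 (s : R) : Omega1 s -> (0 < s ^+ 2)%R.
Proof. by rewrite /Omega1/= in_itv/= andbT => s0; rewrite exprn_gt0. Qed.

Lemma M2_Omega1_sigma_finite P : M2_Omega1 P -> sigma_finite setT P.
Proof.
by move=> M2; apply: in_M2_sigma_finite M2 => //; exact: measurable_Omega1.
Qed.

Lemma tail_sub (x : R) : (0 < x)%R ->
  `]x, +oo[ `<=` Omega1 `&` [set s | (x ^+ 2 <= s ^+ 2)%R].
Proof.
move=> x0 s; rewrite /= /Omega1/= !in_itv/= !andbT => xs.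
split; first exact: lt_trans xs.
by rewrite ler_sqr ?nnegrE ltW// (lt_trans x0).
Qed.

Let measurable_sqr_ge (x : R) :
  measurable (Omega1 `&` [set s | (x ^+ 2 <= s ^+ 2)%R]).
Proof. by apply: measurable_in_M2 => //; exact: measurable_Omega1. Qed.

Lemma tail_lty P (x : R) : M2_Omega1 P -> (0 < x)%R -> tail P x < +oo.
Proof.
move=> M2 x0; apply: (@le_lt_trans _ _
  (P (Omega1 `&` [set s | (x ^+ 2 <= s ^+ 2)%R]))).
  by apply: le_measure; rewrite ?inE//; exact: tail_sub.
by apply: in_M2_lty M2 _ _ => //; [exact: measurable_Omega1|rewrite exprn_gt0].
Qed.

Lemma tail_vanish P (t : R) : M2_Omega1 P -> (0 < t)%R ->
  exists2 x, (0 < x)%R & tail P x <= t%:E.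
Proof.
move=> M2 t0; have [_ Mlt] := M2.
set M := \int[P]_(s in Omega1) (s ^+ 2)%:E in Mlt.
have M0 : 0 <= M by apply: integral_ge0 => s _; rewrite lee_fin sqr_ge0.
have Mfin : M \is a fin_num by rewrite ge0_fin_numE.
(* Markov gives [x ^+ 2 * tail P x <= M]. From [1 <= x] and [M <= x * t] follows [M <= x ^+ 2 * t].
   The summand 1 also keeps [x] positive when [M] is 0. *)
pose x : R := (1 + fine M / t)%R.
have x1 : (1 <= x)%R by rewrite lerDl divr_ge0 ?fine_ge0// ltW.
have x0 : (0 < x)%R by rewrite (lt_le_trans _ x1).
exists x => //.
have x20 : (0 < x ^+ 2)%R by rewrite exprn_gt0.
have tfin : tail P x \is a fin_num by rewrite ge0_fin_numE ?tail_ge0// tail_lty.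
have : (x ^+ 2)%:E * tail P x <= M.
  have := in_M2_markov _ _ _ measurable_Omega1 (measurable_sqr _) sqr_gt0 _ x20.
  move/(_ P)/(le_trans _); apply; rewrite lee_pmul2l ?lte_fin//.
  by apply: le_measure; rewrite ?inE//; exact: tail_sub.
rewrite -(fineK tfin) -(fineK Mfin) -EFinM !lee_fin => xM.
have xt : (fine M <= x ^+ 2 * t)%R.
  apply: (@le_trans _ _ (x * t)%R).
    by rewrite mulrDl mul1r divfK ?gt_eqF// lerDr ltW.
  by rewrite ler_pM2r// expr2 ler_peMl// ltW.
by rewrite -(ler_pM2l x20) (le_trans xM).
Qed.

Lemma tail_inv_lty P (t : R) : M2_Omega1 P -> (0 < t)%R ->
  tail_inv P t%:E < +oo.
Proof.
move=> M2 /(tail_vanish _ _ M2)[x x0 xt].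
by rewrite (@le_lt_trans _ _ x%:E) ?ltry// tail_inv_le// ltW.
Qed.

End tail_theory.

(** Carries the measurability proof, so that the pushforward is a bundled measure while staying
    convertible to [pushforward m f]. *)
Definition pushforward_measure {R : realType} {d1 d2}
    {T1 : measurableType d1} {T2 : measurableType d2}
    (m : {measure set T1 -> \bar R}) (f : T1 -> T2)
    (mf : measurable_fun setT f) : {measure set T2 -> \bar R}.
Proof.
by unshelve refine (pushforward m f : {measure set T2 -> \bar R}).
Defined.

Lemma measure_setD_null {R : realType} {d} {T : measurableType d}
    (m : {measure set T -> \bar R}) (A N : set T) :
  measurable A -> measurable N -> m N = 0 -> m (A `\` N) = m A.
Proof.
move=> mA mN N0; apply/eqP; rewrite eq_le; apply/andP; split.
  by apply: le_measure; rewrite ?inE//; exact: measurableD.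
rewrite -[X in _ <= X]adde0 -[X in _ <= _ + X]N0.
apply: (@le_trans _ _ (m ((A `\` N) `|` N))).
  apply: le_measure; rewrite ?inE//.
    by apply: measurableU => //; exact: measurableD.
  by move=> x Ax; have [Nx|nNx] := pselect (N x); [right|left].
by rewrite measureU2//; exact: measurableD.
Qed.

Arguments pushforward_measure : simpl never.
Arguments tail : simpl never.

Section closed_tail.
Context {R : realType}.
Variable P : {measure set R -> \bar R}.
Hypothesis M2P : M2_Omega1 P.

(** At a positive [x] this is the left limit of the tail; the interval from [tail P x] up to it is
    the jump made by an atom at [x]. *)
Definition closed_tail (x : R) : \bar R := P `[x, +oo[%classic.

Lemma closed_tail_ge0 x : 0 <= closed_tail x. Proof. exact: measure_ge0. Qed.

Lemma measurable_closed_tail : measurable_fun setT closed_tail.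
Proof.
apply: nonincreasing_emeasurable => x y xy; apply: le_measure; rewrite ?inE//.
by move=> z /=; rewrite !in_itv/= !andbT; exact: le_trans.
Qed.

Lemma closed_tail_le (x y : R) : (x < y)%R -> closed_tail y <= tail P x.
Proof.
move=> xy; apply: le_measure; rewrite ?inE//.
by move=> z /=; rewrite !in_itv/= !andbT; exact: lt_le_trans.
Qed.

Lemma closed_tail_lty x : (0 < x)%R -> closed_tail x < +oo.
Proof.
move=> x0; have x20 : (0 < x / 2)%R by rewrite divr_gt0.
rewrite (le_lt_trans (@closed_tail_le (x / 2) _ _))//.
  by rewrite ltr_pdivrMr// ltr_pMr// ltr1n.
exact: tail_lty.
Qed.

Lemma closed_tailE x : closed_tail x = tail P x + P [set x].
Proof.
rewrite /closed_tail -(@setU1itv _ _ _ _ false)//.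
rewrite setUC measureU//; apply/seteqP; split => // z [/=].
by rewrite in_itv/= andbT => /[swap] ->; rewrite ltxx.
Qed.

Lemma closed_tail_ge (x : R) (a : \bar R) : (0 < x)%R ->
  (forall y, (0 < y < x)%R -> a <= tail P y) -> a <= closed_tail x.
Proof.
(* [n.+2] makes the sequence start at [x / 2] instead of 0: continuity from above needs a first ray
   of finite mass, and the tail at 0 may be infinite. *)
move=> x0 aP; pose y n : R := (x - x / n.+2%:R)%R.
have yx n : (0 < y n < x)%R.
  rewrite /y subr_gt0 ltrBlDr ltrDl divr_gt0// andbT.
  by rewrite ltr_pdivrMr// ltr_pMr// ltr1n.
pose F n : set R := `](y n), +oo[%classic.
have IF : \bigcap_n F n = `[x, +oo[%classic.
  apply/seteqP; split => [z zF|z]; rewrite /= in_itv/= andbT; last first.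
    move=> xz n _; rewrite /F/= in_itv/= andbT.
    by apply: lt_le_trans xz; case/andP: (yx n).
  rewrite leNgt; apply/negP => zx.
  have /ltr_add_invr[n] : (z / x < 1)%R by rewrite ltr_pdivrMr// mul1r.
  rewrite -(ltr_pM2r x0) mulrDl divfK ?gt_eqF// mul1r => nz.
  have := zF n Logic.I; rewrite /F/= in_itv/= andbT.
  apply/negP; rewrite -leNgt /y lerBrDr (le_trans _ (ltW nz))// lerD2l.
  by rewrite mulrC ler_pM2r// lef_pV2 ?posrE// ler_nat.
have cvF : P \o F @ \oo --> closed_tail x.
  rewrite /closed_tail -IF; apply: nonincreasing_cvg_mu => //.
  - by apply: tail_lty => //; case/andP: (yx 0%N).
  - by move=> n; exact: measurable_itv.
  - by rewrite IF; exact: measurable_itv.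
  move=> m n mn; apply/subsetPset => z; rewrite /F/= !in_itv/= !andbT.
  apply: le_lt_trans; rewrite /y lerD2l lerN2 ler_pM2l//.
  by rewrite lef_pV2 ?posrE// ler_nat.
rewrite -(cvg_lim _ cvF)//; apply: lime_ge.
  by apply/cvg_ex; exists (closed_tail x).
by apply: nearW => n; exact: aP.
Qed.

End closed_tail.
Arguments closed_tail : simpl never.

(** * The distributional transform *)

Section distributional_transform.
Context {R : realType} {d : measure_display} {T : measurableType d}.
Variables (nu : {measure set T -> \bar R}) (X : T -> R).
Hypothesis mX : measurable_fun setT X.

Let P := pushforward_measure nu X mX.
Hypothesis M2P : M2_Omega1 P.

(* [measurableTypeR R] is [R] with the sigma-algebra on which
   [lebesgue_measure] is a measure; the two structures on [R] do not unify in a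
   product type. *)
Local Notation RL := (measurableTypeR R).

Definition extended_measure : {measure set (T * RL)%type -> \bar R} :=
  product_measure1 nu (@lebesgue_measure R).

Let mm := extended_measure.

(** Cuts Lebesgue measure on the line down to [0, 1]. The condition [0 < X] avoids the tail at 0,
    whose possibly infinite value [fine] would send to 0. *)
Definition transform_domain : set (T * RL) :=
  [set p | (0 < X p.1)%R] `&` [set p | (0 <= p.2 <= 1)%R].

Let D := transform_domain.

(* The second coordinate spreads each atom of [P] uniformly over the jump of the
   tail that it causes. *)
Definition transform (p : T * RL) : R :=
  let U := fine (tail P (X p.1)) in
  (U + p.2 * (fine (closed_tail P (X p.1)) - U))%R.

Let V := transform.

Lemma measurable_transform : measurable_fun setT V.
Proof.
have mX1 : measurable_fun setT (fun p : T * RL => X p.1).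
  exact: measurableT_comp.
have mU : measurable_fun setT (fun p : T * RL => fine (tail P (X p.1))).
  apply: measurableT_comp; first exact: fine_measurable.
  by apply: measurableT_comp; first exact: measurable_tail.
have mC : measurable_fun setT (fun p : T * RL => fine (closed_tail P (X p.1))).
  apply: measurableT_comp; first exact: fine_measurable.
  by apply: measurableT_comp; first exact: measurable_closed_tail.
apply: measurable_funD => //; apply: measurable_funM => //.
exact: measurable_funB.
Qed.

Lemma measurable_transform_domain : measurable D.
Proof.
apply: measurableI.
  rewrite (_ : mkset _ = (X \o fst) @^-1` `]0%R, +oo[%classic).
    by rewrite -[X in measurable X]setTI; apply: measurableT_comp.
  by apply/seteqP; split => p /=; rewrite in_itv/= andbT.
rewrite (_ : mkset _ = snd @^-1` `[0%R, 1%R]%classic).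
  by rewrite -[X in measurable X]setTI; apply: measurable_snd.
by apply/seteqP; split => p /=; rewrite in_itv.
Qed.

Let mlt (a : R) : measurable (D `&` [set p | (V p < a)%R]).
Proof.
apply: measurableI; first exact: measurable_transform_domain.
rewrite (_ : mkset _ = V @^-1` `]-oo, a[%classic).
  by rewrite -[X in measurable X]setTI; apply: measurable_transform.
by apply/seteqP; split => p /=; rewrite in_itv.
Qed.

Let mle (a : R) : measurable (D `&` [set p | (V p <= a)%R]).
Proof.
apply: measurableI; first exact: measurable_transform_domain.
rewrite (_ : mkset _ = V @^-1` `]-oo, a]%classic).
  by rewrite -[X in measurable X]setTI; apply: measurable_transform.
by apply/seteqP; split => p /=; rewrite in_itv.
Qed.

Let rect (A : set R) (B : set RL) : set (T * RL) := (X @^-1` A) `*` B.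

Let rectE (A : set R) (B : set RL) : measurable A -> measurable B ->
  mm (rect A B) = P A * lebesgue_measure B.
Proof.
move=> mA mB; rewrite /mm /extended_measure/= product_measure1E//.
by rewrite -[X in measurable X]setTI; apply: mX.
Qed.

Let mrect (A : set R) (B : set RL) : measurable A -> measurable B ->
  measurable (rect A B).
Proof.
move=> mA mB; apply: measurableX => //.
by rewrite -[X in measurable X]setTI; apply: mX.
Qed.

Let leb0 (b : R) : (0 <= b)%R -> lebesgue_measure `[0%R, b]%classic = b%:E.
Proof.
move=> b0; rewrite lebesgue_measure_itv/= lte_fin sube0.
by case: ltP => // b1; congr EFin; apply/le_anti/andP.
Qed.

Let tailfE x : (0 < x)%R -> (fine (tail P x))%:E = tail P x.
Proof.
by move=> x0; rewrite fineK// ge0_fin_numE ?tail_ge0// tail_lty.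
Qed.

Let ctailfE x : (0 < x)%R -> (fine (closed_tail P x))%:E = closed_tail P x.
Proof.
by move=> x0; rewrite fineK// ge0_fin_numE ?closed_tail_ge0// closed_tail_lty.
Qed.

Let atom x : R := (fine (closed_tail P x) - fine (tail P x))%R.

Let atomE x : (0 < x)%R -> P [set x] = (atom x)%:E.
Proof.
move=> x0; rewrite EFinB ctailfE// tailfE// closed_tailE addeAC subee ?add0e//.
by rewrite -tailfE.
Qed.

Let atom_ge0 x : (0 < x)%R -> (0 <= atom x)%R.
Proof. by move=> x0; rewrite -lee_fin -atomE//. Qed.

Let tail_le_transform p : D p -> tail P (X p.1) <= (V p)%:E.
Proof.
move=> [/= X0 /andP[u0 _]]; rewrite -tailfE// lee_fin lerDl.
by rewrite mulr_ge0//; exact: atom_ge0.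
Qed.

Let transform_le_ctail p : D p -> (V p)%:E <= closed_tail P (X p.1).
Proof.
move=> [/= X0 /andP[_ u1]]; rewrite -(ctailfE _ X0) lee_fin /V /transform/=.
rewrite -lerBrDl ler_piMl//; exact: atom_ge0.
Qed.

Let transform_le_tail p x : D p -> (x < X p.1)%R -> (V p)%:E <= tail P x.
Proof.
by move=> Dp /(closed_tail_le P); apply: le_trans; exact: transform_le_ctail.
Qed.

Let inv_tail (a : R) : (0 < a)%R ->
  exists2 z : R, (0 <= z)%R & tail_inv P a%:E = z%:E.
Proof.
move=> a0; have fz : tail_inv P a%:E \is a fin_num.
  by rewrite ge0_fin_numE ?tail_inv_ge0// tail_inv_lty.
exists (fine (tail_inv P a%:E)); last by rewrite fineK.
by rewrite fine_ge0// tail_inv_ge0.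
Qed.

(** Let [z] be the inverse of the tail [U] at [a]. Where [X < z], [V] is at least a tail above [a],
    so [V < a] leaves only [X > z], of mass [U(z)], and the part of the atom at [z] with [u] at most
    [(a - U(z)) / atom z], of mass at most [a - U(z)]. *)
Let measure_lt_le (a : R) : (0 < a)%R ->
  mm (D `&` [set p | (V p < a)%R]) <= a%:E.
Proof.
move=> a0; have [z z0 zE] := inv_tail _ a0.
have tza : tail P z <= a%:E by rewrite -tail_inv_le// zE.
have gtz s : (0 < s < z)%R -> a%:E < tail P s.
  by move=> /andP[s0 sz]; rewrite -lt_tail_inv ?ltW// zE lte_fin.
(* If [z = 0], the whole domain lies over [X > z] and no atom has to be split. *)
move: z0; rewrite le_eqVlt => /orP[/eqP z0|z0].
  apply: le_trans tza; rewrite -z0 -[leRHS]mule1 -lebesgue_unit_itv -rectE//.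
  apply: le_measure; rewrite ?inE//; first exact: mrect.
  by move=> [s u] [[/= ? ?] _]; split => /=; rewrite in_itv/= ?andbT.
(* Without an atom at [z] there is no quotient to form; all of [0, 1] is taken, over a null set. *)
pose B : set R := if atom z == 0%R then `[0%R, 1%R]%classic
  else `[0%R, ((a - fine (tail P z)) / atom z)%R]%classic.
have mB : measurable B by rewrite /B; case: ifP => _; exact: measurable_itv.
have atz : (fine (tail P z) <= a)%R by rewrite -lee_fin tailfE.
have BE : (atom z)%:E * lebesgue_measure B <= (a - fine (tail P z))%:E.
  rewrite /B; case: eqP => [->|/eqP at0].
    by rewrite mul0e lee_fin subr_ge0.
  rewrite leb0 ?divr_ge0 ?atom_ge0 ?subr_ge0//.
  by rewrite -EFinM mulrC divfK.
apply: (@le_trans _ _ (mm (rect `]z, +oo[ `[0%R, 1%R] `|` rect [set z] B))).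
  apply: le_measure; rewrite ?inE//.
    by apply: measurableU; apply: mrect.
  move=> [s u] [[/= X0 u01] Va].
  have [Xz|Xz|Xz] := ltgtP (X s) z.
  - have Dsu : D (s, u) by split.
    have := lt_le_trans (gtz (X s) _) (tail_le_transform _ Dsu).
    by rewrite X0 Xz => /(_ isT); rewrite lte_fin ltNge (ltW Va).
  - by left; split => /=; rewrite in_itv/= ?andbT.
  right; split => //=; rewrite /B; case: ifPn => [_|at0]; rewrite /= in_itv//=.
  case/andP: u01 => -> _ /=; rewrite ler_pdivlMr; last first.
    by rewrite lt_def at0 atom_ge0.
  by rewrite lerBrDl; apply: ltW; move: Va; rewrite /V /transform/= Xz.
apply: (@le_trans _ _ (mm (rect `]z, +oo[ `[0%R, 1%R]) + mm (rect [set z] B))).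
  by apply: measureU2; exact: mrect.
rewrite !rectE// lebesgue_unit_itv mule1 atomE//.
apply: le_trans (leeD2l _ BE) _.
by rewrite -[X in X + _]tailfE// -EFinD addrC subrK.
Qed.

(** The same decomposition, now as an inclusion from below. The bound [a <= closed_tail P z] makes
    the slice of the atom fit into [0, 1]; at [z = 0], where no atom is cut, the hypothesis
    [a <= tail P 0] takes its place. *)
Let measure_le_ge (a : R) : (0 < a)%R -> a%:E <= tail P 0 ->
  a%:E <= mm (D `&` [set p | (V p <= a)%R]).
Proof.
move=> a0 aP; have [z z0 zE] := inv_tail _ a0.
have tza : tail P z <= a%:E by rewrite -tail_inv_le// zE.
have gtz s : (0 < s < z)%R -> a%:E <= tail P s.
  by move=> /andP[s0 sz]; apply: ltW; rewrite -lt_tail_inv ?ltW// zE lte_fin.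
have inD s u : (z < X s)%R -> (0 <= u <= 1)%R ->
    (D `&` [set p | (V p <= a)%R]) (s, u).
  move=> zX u01; have Dsu : D (s, u) by split => //=; exact: le_lt_trans zX.
  split => //; rewrite /= -lee_fin; apply: le_trans tza.
  exact: transform_le_tail.
have rect_sub : rect `]z, +oo[ `[0%R, 1%R] `<=`
    D `&` [set p | (V p <= a)%R].
  move=> [s u] [/=]; rewrite !in_itv/= andbT; exact: inD.
have tail_case : a%:E <= tail P z -> a%:E <= mm (D `&` [set p | (V p <= a)%R]).
  move=> atz; apply: (le_trans atz).
  rewrite -[leLHS]mule1 -lebesgue_unit_itv -rectE//.
  by apply: le_measure; rewrite ?inE//; exact: mrect.
move: (z0); rewrite le_eqVlt => /orP[/eqP z00|z0'].
  by apply: tail_case; rewrite -z00.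
have act := closed_tail_ge P M2P _ _ z0' gtz.
have [at0|at0] := eqVneq (atom z) 0%R.
  by apply: tail_case; move: act; rewrite closed_tailE atomE// at0 adde0.
have at_gt0 : (0 < atom z)%R by rewrite lt_def at0 atom_ge0.
have atz : (fine (tail P z) <= a)%R by rewrite -lee_fin tailfE.
pose b : R := ((a - fine (tail P z)) / atom z)%R.
have b0 : (0 <= b)%R by rewrite divr_ge0 ?atom_ge0 ?subr_ge0.
have b1 : (b <= 1)%R.
  rewrite ler_pdivrMr// mul1r lerBlDl.
  by move: act; rewrite closed_tailE atomE// -tailfE// -EFinD lee_fin.
apply: (@le_trans _ _
  (mm (rect `]z, +oo[ `[0%R, 1%R] `|` rect [set z] `[0%R, b]))).
  have -> : mm (rect `]z, +oo[ `[0%R, 1%R] `|` rect [set z] `[0%R, b]) =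
      mm (rect `]z, +oo[ `[0%R, 1%R]) + mm (rect [set z] `[0%R, b]).
    apply: measureU; [exact: mrect|exact: mrect|].
    apply/seteqP; split => // -[s u] [[/=]].
    rewrite in_itv/= andbT => zX _ [] Xz.
    by move: zX; rewrite Xz ltxx.
  rewrite !rectE// lebesgue_unit_itv mule1 atomE// leb0// -EFinM.
  rewrite -[X in X + _](tailfE _ z0') -EFinD lee_fin.
  by rewrite /b mulrC divfK// addrC subrK.
apply: le_measure; rewrite ?inE//; first by apply: measurableU; apply: mrect.
move=> su [/rect_sub//|]; case: su => s u [/= Xz].
rewrite in_itv/= => /andP[u0 ub]; split.
  by split => /=; rewrite ?Xz// u0 (le_trans ub).
rewrite /= /V /transform/= Xz -lerBrDl -ler_pdivlMr//.
Qed.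

(** The upper bound concerns [V < a], the lower one [V <= a - e]; letting [e] tend to 0 closes the
    gap. *)
Lemma transform_law (a : R) : (0 <= a)%R -> a%:E <= tail P 0 ->
  mm (D `&` [set p | (V p < a)%R]) = a%:E.
Proof.
rewrite le_eqVlt => /orP[/eqP <- _|a0 aP].
  rewrite (_ : D `&` _ = set0) ?measure0//.
  apply/seteqP; split => // p [Dp]; rewrite /= ltNge -lee_fin.
  by rewrite (le_trans _ (tail_le_transform _ Dp))// tail_ge0.
apply/eqP; rewrite eq_le measure_lt_le//=.
apply/lee_addgt0Pr => e e0.
(* For [a <= e] the claim is trivial; otherwise [a - e] is positive, as [measure_le_ge] requires. *)
have [ea|ae] := ltP e a; last first.
  by rewrite (@le_trans _ _ e%:E) ?lee_fin// leeDr.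
have ae0 : (0 < a - e)%R by rewrite subr_gt0.
rewrite -leeBlDr// -EFinB.
apply: (@le_trans _ _ (mm (D `&` [set p | (V p <= a - e)%R]))).
  by apply: measure_le_ge => //; rewrite (le_trans _ aP)// lee_fin gerBl ltW.
apply: le_measure; rewrite ?inE//.
by move=> p [Dp] /= Vp; split => //=; rewrite (le_lt_trans Vp)// gtrBl.
Qed.

Lemma transform_null : mm (D `&` [set p | (V p <= 0)%R]) = 0.
Proof.
apply/eqP; rewrite eq_le measure_ge0 andbT; apply/lee_addgt0Pr => e e0.
rewrite add0e (le_trans _ (measure_lt_le _ e0))//.
apply: le_measure; rewrite ?inE//.
by move=> p [Dp] /= Vp; split => //=; rewrite (le_lt_trans Vp).
Qed.

(** [V] decreases as [X] grows, so within the domain one event contains the other: if [U(x) < a],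
    then [X > x] forces [V <= U(x) < a]; if [a <= U(x)], then [X <= x] forces [V >= U(x) >= a]. *)
Lemma transform_joint_law (x a : R) : (0 < x)%R -> (0 <= a)%R ->
  a%:E <= tail P 0 ->
  mm (D `&` [set p | (x < X p.1)%R] `&` [set p | (V p < a)%R]) =
  mine (tail P x) a%:E.
Proof.
move=> x0 a0 aP; have [Pxa|aPx] := ltP (tail P x) a%:E.
  rewrite -[RHS]mule1 -lebesgue_unit_itv -rectE//; congr (mm _).
  apply/seteqP; split => [[s u] [[[_ /= u01] /= xX] _]|[s u]].
    by split; rewrite /= in_itv/= ?andbT.
  rewrite /rect/= !in_itv/= andbT => -[xX u01].
  have Dsu : D (s, u) by split => //=; exact: lt_trans xX.
  split => //=; rewrite -lte_fin; apply: le_lt_trans Pxa.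
  exact: transform_le_tail.
rewrite -[RHS]transform_law//; congr (mm _); apply/seteqP; split => [p|p].
  by move=> [[]].
move=> [Dp /= Va]; do 2 split => //=; rewrite ltNge; apply/negP => Xx.
have := le_trans aPx (le_tail P _ _ Xx).
move=> /le_trans/(_ (tail_le_transform _ Dp)).
by rewrite lee_fin leNgt Va.
Qed.

End distributional_transform.

(** * Uniqueness of a measure with given tails *)

Section tail_determines.
Context {R : realType}.

(** Mass may accumulate at 0, so uniqueness on the generating rays is applied to the restrictions to
    []1 / (n + 1), +oo[], where tails are finite; continuity from below then reaches every Borel
    subset of [Omega1]. *)
Lemma eq_tail_eq_on (m1 m2 : {measure set R -> \bar R}) :
  (forall y, (0 < y)%R -> tail m1 y = tail m2 y) ->
  (forall y, (0 < y)%R -> tail m2 y < +oo) ->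
  eq_on Omega1 m1 m2.
Proof.
move=> m12 m2fin A mA A0.
pose O n : set R := `](n.+1%:R^-1)%R, +oo[%classic.
have mO n : measurable (O n) by exact: measurable_itv.
have eqn n B : measurable B -> m1 (B `&` O n) = m2 (B `&` O n).
  move=> mB.
  have rayI (y : R) :
      `]y, +oo[ `&` O n = `](Num.max y n.+1%:R^-1)%R, +oo[%classic.
    apply/seteqP; split => z; rewrite /O/= !in_itv/= !andbT gt_max.
      by move=> [-> ->].
    by move/andP.
  have mx0 (y : R) : (0 < Num.max y n.+1%:R^-1)%R.
    by rewrite lt_max invr_gt0 ltr0n orbT.
  have rayE (y : R) :
      mrestr m1 (mO n) `]y, +oo[%classic = mrestr m2 (mO n) `]y, +oo[%classic.
    by rewrite /mrestr rayI; exact: m12.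
  apply: (@measure_unique _ R _ (@RGenOInfty.G R)
    (fun k => `](- k%:R)%R, +oo[%classic) _ _ _ _
    (mrestr m1 (mO n)) (mrestr m2 (mO n)) _ _ B mB).
  - exact: RGenOInfty.measurableE.
  - move=> _ _ [a ->] [b ->]; exists (Num.max a b)%R.
    apply/seteqP; split => z; rewrite /= !in_itv/= !andbT gt_max.
      by move=> [-> ->].
    by move/andP.
  - by move=> k; exists (- k%:R)%R.
  - apply/seteqP; split => // z _.
    exists (Num.bound `|z|%R) => //; rewrite /= in_itv/= andbT ltrNl.
    apply: le_lt_trans (archi_boundP (normr_ge0 z)).
    by rewrite ler_normr lexx orbT.
  - by move=> _ [y ->]; exact: rayE.
  - move=> k; rewrite [X in X < _](rayE (- k%:R)%R).
    by rewrite /mrestr rayI; exact: m2fin.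
pose F n := A `&` O n.
have UF : \bigcup_n F n = A.
  apply/seteqP; split => [z [n _ []]//|z Az].
  have := A0 _ Az; rewrite /Omega1/= in_itv/= andbT => /ltr_add_invr[n].
  rewrite add0r => nz; exists n => //; split => //.
  by rewrite /O/= in_itv/= andbT.
have ndF : nondecreasing_seq F.
  move=> i j ij; apply/subsetPset; apply: setIS => z.
  rewrite /O/= !in_itv/= !andbT.
  by apply: le_lt_trans; rewrite lef_pV2 ?posrE// ler_nat.
have mF n : measurable (F n) by exact: measurableI.
have cv (m : {measure set R -> \bar R}) : m \o F @ \oo --> m A.
  have := @nondecreasing_cvg_mu _ _ _ m F mF _ ndF; rewrite UF; exact.
rewrite -(cvg_lim _ (cv m1))// -(cvg_lim _ (cv m2))//; apply/congr_lim.
by apply/funext => n; exact: eqn.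
Qed.

End tail_determines.

(** * The monotone coupling of two measures on the half-line *)

Section monotone_coupling.
Context {R : realType} {d : measure_display} {T : measurableType d}.
Variables (nu : {measure set T -> \bar R}) (X : T -> R).
Hypothesis mX : measurable_fun setT X.
Variable Q : {measure set R -> \bar R}.

Let P := pushforward_measure nu X mX.
Hypotheses (M2P : M2_Omega1 P) (M2Q : M2_Omega1 Q).
Hypothesis QP : forall y, (0 < y)%R -> tail Q y <= tail P 0.

Local Notation RL := (measurableTypeR R).
Let mm := extended_measure nu.
Let D := transform_domain X.
Let V := transform nu X mX.

(* [fine] is harmless: [tail_inv Q] is infinite at most where the transform
   vanishes, a null set. *)
Definition quantile (p : T * RL) : R := fine (tail_inv Q (V p)%:E).

Lemma quantile_ge0 p : (0 <= quantile p)%R.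
Proof. by rewrite fine_ge0// tail_inv_ge0. Qed.

Lemma measurable_quantile : measurable_fun setT quantile.
Proof.
apply: measurableT_comp; first exact: fine_measurable.
apply: (measurableT_comp (measurable_tail_inv Q)).
exact: measurable_transform.
Qed.

Let mD : measurable D := measurable_transform_domain X mX.

Let mV_le0 : measurable (D `&` [set p | (V p <= 0)%R]).
Proof.
apply: measurableI => //.
rewrite (_ : mkset _ = V @^-1` `]-oo, 0%R]%classic).
  by rewrite -[X in measurable X]setTI; apply: measurable_transform.
by apply/seteqP; split => p /=; rewrite in_itv.
Qed.

Let tail_fineE y : (0 < y)%R -> tail Q y = (fine (tail Q y))%:E.
Proof. by move=> y0; rewrite fineK// ge0_fin_numE ?tail_ge0// tail_lty. Qed.

Lemma measurable_quantile_gt y : measurable [set p | (y < quantile p)%R].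
Proof.
rewrite (_ : mkset _ = quantile @^-1` `]y, +oo[%classic).
  by rewrite -[X in measurable X]setTI; apply: measurable_quantile.
by apply/seteqP; split => p /=; rewrite in_itv/= andbT.
Qed.

Let measurable_X_gt (x : R) : measurable [set p : T * RL | (x < X p.1)%R].
Proof.
rewrite (_ : mkset _ = (X \o fst) @^-1` `]x, +oo[%classic).
  by rewrite -[X in measurable X]setTI; apply: measurableT_comp.
by apply/seteqP; split => p /=; rewrite in_itv/= andbT.
Qed.

(** Off the null set [V <= 0] the inverse is finite and [lt_tail_inv] exchanges the two events. [C]
    leaves room for a condition on [X]; the whole space gives the marginal law. *)
Let quantile_transform (C : set (T * RL)) (y : R) : measurable C -> (0 < y)%R ->
  mm (D `&` C `&` [set p | (y < quantile p)%R]) =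
  mm (D `&` C `&` [set p | (V p < fine (tail Q y))%R]).
Proof.
move=> mC y0; have mDC : measurable (D `&` C) by exact: measurableI.
pose N := D `&` [set p | (V p <= 0)%R].
have N0 : mm N = 0 by exact: transform_null.
have mV : measurable [set p | (V p < fine (tail Q y))%R].
  rewrite (_ : mkset _ = V @^-1` `]-oo, (fine (tail Q y))[%classic).
    by rewrite -[X in measurable X]setTI; apply: measurable_transform.
  by apply/seteqP; split => p /=; rewrite in_itv.
rewrite -(measure_setD_null mm _ N)//; last first.
  by apply: measurableI => //; exact: measurable_quantile_gt.
rewrite -[RHS](measure_setD_null mm _ N)//; last exact: measurableI.
congr (mm _).
have H p : D p -> ~ N p -> (y < quantile p)%R = (V p < fine (tail Q y))%R.
  move=> Dp Np; have V0 : (0 < V p)%R.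
    by rewrite ltNge; apply/negP => V0; apply: Np.
  rewrite /quantile -lte_fin fineK ?ge0_fin_numE ?tail_inv_ge0 ?tail_inv_lty//.
  by rewrite lt_tail_inv ?ltW// tail_fineE// lte_fin.
by apply/seteqP; split => [p [[[Dp ?] /= pq] Np]|p [[[Dp ?] /= pq] Np]];
  split => //; split => //=; rewrite ?H// -H.
Qed.

(** [X] and the quantile have the largest joint tail that their marginals allow. *)
Lemma quantile_joint_law (x y : R) : (0 < x)%R -> (0 < y)%R ->
  mm (D `&` [set p | (x < X p.1)%R] `&` [set p | (y < quantile p)%R]) =
  mine (tail P x) (tail Q y).
Proof.
move=> x0 y0; rewrite quantile_transform// [in RHS](tail_fineE _ y0).
apply: (transform_joint_law nu X mX M2P) => //.
  by rewrite fine_ge0// tail_ge0.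
by rewrite -tail_fineE// QP.
Qed.

(** Tails determine the law, and [QP] keeps each level [tail Q y] in the range where [V] is
    distributed as Lebesgue measure. *)
Lemma quantile_law : eq_on Omega1
  (pushforward (mrestr mm mD) quantile) Q.
Proof.
apply: (eq_tail_eq_on (pushforward_measure (mrestr mm mD) quantile
  measurable_quantile)) => y y0; last exact: tail_lty.
rewrite /tail /pushforward_measure /= /pushforward/= /mrestr setIC -[D]setIT.
rewrite [X in mm (_ `&` X)](_ : _ = [set p | (y < quantile p)%R]); last first.
  by apply/seteqP; split => p /=; rewrite in_itv/= andbT.
rewrite quantile_transform// setIT.
rewrite (transform_law nu X mX M2P) -?tail_fineE ?QP//.
by rewrite fine_ge0// tail_ge0.
Qed.

End monotone_coupling.

(** * Couplings with the diagonal measure *)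

Arguments sqnorm : simpl never.
Arguments sqnorm2 : simpl never.
Arguments sqdist : simpl never.

Section tuples.
Context {R : realType} {d : nat}.
Implicit Types s : d.-tuple R.

Definition coord_sum s : R := (\sum_(i < d) tnth s i)%R.

Definition diag (r : R) : d.-tuple R := [tuple r | i < d].

Lemma tnth_diag r i : tnth (diag r) i = r.
Proof. by rewrite tnth_mktuple. Qed.

Lemma measurable_coord_sum : measurable_fun setT coord_sum.
Proof. by apply: measurable_sum => i; exact: measurable_tnth. Qed.

Lemma measurable_diag : measurable_fun setT diag.
Proof.
apply/measurable_fun_tnthP => i.
rewrite (_ : _ \o _ = id); first exact: measurable_id.
by apply/funext => r /=; rewrite tnth_diag.
Qed.

Lemma measurable_sqnorm : measurable_fun setT (@sqnorm R d).
Proof.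
by apply: measurable_sum => i; apply: measurable_funX; exact: measurable_tnth.
Qed.

Lemma measurable_sqdist : measurable_fun setT (@sqdist R d).
Proof.
apply: measurable_sum => i; apply: measurable_funX; apply: measurable_funB.
  by apply: (measurableT_comp (measurable_tnth i)).
by apply: (measurableT_comp (measurable_tnth i)).
Qed.

Lemma measurable_sqnorm2 : measurable_fun setT (@sqnorm2 R d).
Proof.
by apply: measurable_funD; apply: (measurableT_comp measurable_sqnorm).
Qed.

Lemma sqnorm_ge0 s : (0 <= sqnorm s)%R.
Proof. by apply: sumr_ge0 => i _; exact: sqr_ge0. Qed.

Lemma sqdist_ge0 (p : d.-tuple R * d.-tuple R) : (0 <= sqdist p)%R.
Proof. by apply: sumr_ge0 => i _; exact: sqr_ge0. Qed.

Lemma sqnorm_eq0 s : (sqnorm s == 0)%R = (s == origin d).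
Proof.
apply/idP/eqP => [|->]; last first.
  by rewrite /sqnorm big1// => i _; rewrite tnth_mktuple expr0n.
rewrite psumr_eq0 => [/allP s0|i _]; last exact: sqr_ge0.
apply: eq_from_tnth => i; rewrite tnth_mktuple.
by have := s0 i (mem_index_enum _); rewrite sqrf_eq0 => /eqP.
Qed.

Lemma sqdist_eq0 s t : sqdist (s, t) = 0%R -> s = t.
Proof.
move=> /eqP; rewrite psumr_eq0 => [/allP st|i _]; last exact: sqr_ge0.
apply: eq_from_tnth => i.
by have := st i (mem_index_enum _); rewrite sqrf_eq0 subr_eq0 => /eqP.
Qed.

(** Positivity of the norm in place of removal of the origin: this form is visibly measurable and
    matches [coord_sum_gt0]. *)
Lemma OmegaE : @Omega R d = orthant d `&` [set s | (0 < sqnorm s)%R].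
Proof.
apply/seteqP; split => s [os] /= s0; split => //=.
  by rewrite lt_def sqnorm_ge0 andbT sqnorm_eq0; apply/eqP.
by move=> so; move: s0; rewrite lt_def sqnorm_eq0 so eqxx.
Qed.

(** Besides measurability, this form supplies the positivity of [sqnorm2] that [in_M2_sigma_finite]
    asks for. *)
Lemma Omega2E : @Omega2 R d =
  (orthant d `*` orthant d) `&` [set p | (0 < sqnorm2 p)%R].
Proof.
apply/seteqP; split => -[s t] [/= ost] st0; split => //=.
  rewrite lt_def addr_ge0 ?sqnorm_ge0// andbT.
  rewrite paddr_eq0 ?sqnorm_ge0// !sqnorm_eq0.
  apply/negP => /andP[/eqP ss /eqP tt].
  by apply: st0; congr pair.
move=> [ss tt]; move: st0; rewrite lt_def paddr_eq0 ?sqnorm_ge0//.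
by rewrite !sqnorm_eq0 ss tt eqxx.
Qed.

Lemma measurable_orthant : measurable (@orthant R d).
Proof.
rewrite (_ : orthant d =
    \bigcap_(i in [set: 'I_d]) [set s | (0 <= tnth s i)%R]).
  apply: fin_bigcap_measurable => // i _.
  rewrite (_ : mkset _ = (@tnth _ R ^~ i) @^-1` `[0%R, +oo[%classic).
    by rewrite -[X in measurable X]setTI; apply: measurable_tnth.
  by apply/seteqP; split => s /=; rewrite in_itv/= andbT.
by apply/seteqP; split => s /= os i => [_|]; exact: os.
Qed.

Lemma measurable_Omega : measurable (@Omega R d).
Proof.
rewrite OmegaE; apply: measurableI; first exact: measurable_orthant.
rewrite (_ : mkset _ = sqnorm @^-1` `]0%R, +oo[%classic).
  by rewrite -[X in measurable X]setTI; apply: measurable_sqnorm.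
by apply/seteqP; split => s /=; rewrite in_itv/= andbT.
Qed.

Lemma measurable_Omega2 : measurable (@Omega2 R d).
Proof.
rewrite Omega2E; apply: measurableI.
  by apply: measurableX; exact: measurable_orthant.
rewrite (_ : mkset _ = sqnorm2 @^-1` `]0%R, +oo[%classic).
  by rewrite -[X in measurable X]setTI; apply: measurable_sqnorm2.
by apply/seteqP; split => s /=; rewrite in_itv/= andbT.
Qed.

Lemma tnth_le_coord_sum s i : orthant d s -> (tnth s i <= coord_sum s)%R.
Proof.
by move=> os; rewrite /coord_sum (bigD1 i)//= lerDl sumr_ge0.
Qed.

Lemma coord_sum_ge0 s : orthant d s -> (0 <= coord_sum s)%R.
Proof. by move=> os; exact: sumr_ge0. Qed.

Lemma coord_sum_gt0 s : orthant d s -> (0 < coord_sum s)%R = (0 < sqnorm s)%R.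
Proof.
move=> os; rewrite !lt_def coord_sum_ge0// sqnorm_ge0 !andbT; congr (~~ _).
rewrite !psumr_eq0//; first last.
- by move=> i _; exact: sqr_ge0.
by apply: eq_all => i /=; rewrite sqrf_eq0.
Qed.

(** The constant comes from [s_i s_j <= s_i^2 + s_j^2] summed over all pairs; it serves only to make
    the second moment of [nu_plus nu] finite. *)
Lemma coord_sum_sqr_le s : (coord_sum s ^+ 2 <= (2 * d)%:R * sqnorm s)%R.
Proof.
rewrite expr2 /coord_sum mulr_suml.
under eq_bigr do rewrite mulr_sumr.
apply: (@le_trans _ _
  (\sum_(i < d) \sum_(j < d) (tnth s i ^+ 2 + tnth s j ^+ 2))%R).
  by apply: ler_sum => i _; apply: ler_sum => j _; nra.
under eq_bigr do rewrite big_split/= sumr_const card_ord.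
rewrite big_split/= sumr_const card_ord sumrMnl -/(sqnorm s).
by rewrite -mulr2n -mulrnA muln2 -mul2n mulr_natl.
Qed.

Lemma sqdist_diag s r :
  (sqdist (s, diag r) + 2 * (coord_sum s * r) = sqnorm s + sqnorm (diag r))%R.
Proof.
rewrite /sqdist /coord_sum /sqnorm mulr_suml mulr_sumr -!big_split/=.
by apply: eq_bigr => i _; rewrite tnth_diag; ring.
Qed.

End tuples.

Arguments coord_sum : simpl never.
Arguments diag : simpl never.

(** Moves an integral from the set that carries [m] to the preimage of a set under a projection,
    where a marginal is known. [E] may leave [D], since the excess is null. *)
Lemma integral_support {R : realType} {disp} {T : measurableType disp}
    (m : {measure set T -> \bar R}) (D E : set T) (f : T -> \bar R) :
  measurable D -> measurable E -> measurable_fun setT f ->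
  (forall x, 0 <= f x) -> (forall x, D x -> ~ E x -> f x = 0) ->
  m (~` D) = 0 -> \int[m]_(x in D) f x = \int[m]_(x in E) f x.
Proof.
move=> mD mE mf f0 fDE mDC.
rewrite [RHS](ge0_negligible_integral _ _ _ _ mDC)//; last 2 first.
- exact: measurableC.
- exact: measurable_funS mf.
rewrite setDE setCK integral_mkcond [RHS]integral_mkcond.
apply: eq_integral => x _; rewrite !patchE in_setI.
have [Dx|] := boolP (x \in D); last by rewrite andbF.
rewrite andbT; have [//|] := boolP (x \in E); rewrite notin_setE => nEx.
by apply: fDE => //; exact: set_mem.
Qed.

(** * Second moments computed from the marginals *)

Section marginals.
Context {R : realType} {d : nat}.
Hypothesis hd : (0 < d)%N.
Variable nu : {measure set (d.-tuple R) -> \bar R}.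
Hypothesis hnu : M2_Omega nu.
Variable nubar : {measure set R -> \bar R}.
Hypothesis hmarg : forall i : 'I_d,
  eq_on Omega1 (pushforward nu (fun s : d.-tuple R => tnth s i)) nubar.

Let i0 := Ordinal hd.
Let nuC := pushforward_measure nubar (@diag R d) measurable_diag.

Let nuC0 : nu (~` Omega d) = 0.
Proof. by case: hnu. Qed.

Let msqnormE : measurable_fun setT (fun s : d.-tuple R => (sqnorm s)%:E).
Proof. by apply/measurable_EFinP; exact: measurable_sqnorm. Qed.

Let msqr (D : set R) : measurable_fun D (fun r => (r ^+ 2)%:E).
Proof. by apply/measurable_EFinP; exact: exprn_measurable. Qed.

Lemma M2_nu_plus : M2_Omega1 (nu_plus nu).
Proof.
have mS : measurable_fun setT (fun s : d.-tuple R => (coord_sum s ^+ 2)%:E).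
  apply/measurable_EFinP; apply: measurable_funX.
  exact: measurable_coord_sum.
have mSO : measurable (coord_sum @^-1` @Omega1 R : set (d.-tuple R)).
  rewrite -[X in measurable X]setTI.
  by apply: measurable_coord_sum => //; exact: measurable_Omega1.
split.
  apply/eqP; rewrite eq_le measure_ge0; last first.
    exact: measurable_coord_sum.
  rewrite andbT -nuC0 [leLHS](_ : _ = nu (coord_sum @^-1` (~` Omega1)))//.
  apply: le_measure; rewrite ?inE.
  - by rewrite preimage_setC; exact: measurableC.
  - by apply: measurableC; exact: measurable_Omega.
  move=> s /=; apply: contra_not; rewrite OmegaE => -[os /= s0].
  by rewrite /Omega1/= in_itv/= andbT -/(coord_sum s) coord_sum_gt0.
rewrite ge0_integral_pushforward//; first last.
- by move=> r _; rewrite lee_fin sqr_ge0.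
- exact: measurable_Omega1.
- exact: measurable_coord_sum.
rewrite -(integral_support nu (Omega d) _ (fun s => (coord_sum s ^+ 2)%:E))//.
- apply: (@le_lt_trans _ _
    (\int[nu]_(s in Omega d) ((2 * d)%:R%:E * (sqnorm s)%:E))).
    apply: ge0_le_integral => //.
    + exact: measurable_Omega.
    + by move=> s _; rewrite lee_fin sqr_ge0.
    + exact: measurable_funS mS.
    + by apply: measurable_funeM; exact: measurable_funS msqnormE.
    + by move=> s _; rewrite -EFinM lee_fin coord_sum_sqr_le.
  rewrite ge0_integralZl//; first last.
  - by move=> s _; rewrite lee_fin sqnorm_ge0.
  - exact: measurable_funS msqnormE.
  - exact: measurable_Omega.
  by rewrite lte_mul_pinfty//; case: hnu.
- exact: measurable_Omega.
- by move=> s; rewrite lee_fin sqr_ge0.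
move=> s [os _] /negP; rewrite /Omega1/= in_itv/= andbT -/(coord_sum s).
rewrite coord_sum_gt0// lt_def sqnorm_ge0 andbT negbK sqnorm_eq0 => /eqP ->.
by rewrite /coord_sum big1 ?expr0n// => i _; rewrite tnth_mktuple.
Qed.

(** The marginal says nothing about the points of [Omega d] whose [i]-th coordinate is 0, possibly
    of infinite mass, but [s_i^2] vanishes there. *)
Lemma integral_sqnorm :
  \int[nu]_(s in Omega d) (sqnorm s)%:E = d%:R%:E * second_moment nubar.
Proof.
have mc i : measurable_fun setT (fun s : d.-tuple R => (tnth s i ^+ 2)%:E).
  by apply/measurable_EFinP; apply: measurable_funX; exact: measurable_tnth.
under eq_integral do rewrite /sqnorm -sumEFin.
rewrite ge0_integral_sum//; first last.
- by move=> i s _; rewrite lee_fin sqr_ge0.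
- by move=> i; exact: measurable_funS (mc i).
- exact: measurable_Omega.
rewrite (eq_bigr (fun=> second_moment nubar)) => [|i _].
  by rewrite [RHS]mule_natl sumr_const card_ord.
have mi : measurable ((fun s : d.-tuple R => tnth s i) @^-1` Omega1).
  rewrite -[X in measurable X]setTI.
  by apply: measurable_tnth => //; exact: measurable_Omega1.
rewrite (integral_support nu (Omega d) _ (fun s => (tnth s i ^+ 2)%:E) _ mi)//.
- pose m := pushforward_measure nu (fun s : d.-tuple R => tnth s i)
    (measurable_tnth i).
  rewrite /second_moment [RHS](eq_measure_integral m); last first.
    by move=> A mA A0; rewrite -(hmarg i).
  rewrite [RHS]ge0_integral_pushforward//; first last.
  + by move=> r _; rewrite lee_fin sqr_ge0.
  + exact: measurable_Omega1.
  + exact: measurable_tnth.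
- exact: measurable_Omega.
- by move=> s; rewrite lee_fin sqr_ge0.
move=> s [os _]; rewrite /Omega1/= in_itv/= andbT => /negP.
by rewrite -leNgt => si; rewrite (@le_anti _ R (tnth s i) 0%R) ?expr0n// si os.
Qed.

Lemma diag_Omega (r : R) : Omega d (diag r) <-> Omega1 r.
Proof.
rewrite OmegaE /Omega1/= in_itv/= andbT; split => [[od /= s0]|r0].
  have := od i0; rewrite tnth_diag le_eqVlt => /orP[/eqP r0|//].
  have := lt0r_neq0 s0; rewrite sqnorm_eq0 => /eqP [].
  by apply: eq_from_tnth => i; rewrite tnth_diag tnth_mktuple r0.
have od : orthant d (diag r) by move=> i; rewrite tnth_diag ltW.
split => //=; rewrite -coord_sum_gt0// (lt_le_trans r0)//.
by rewrite -[leLHS](tnth_diag r i0) tnth_le_coord_sum.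
Qed.

Lemma integral_sqnorm_co :
  \int[nuC]_(s in Omega d) (sqnorm s)%:E = d%:R%:E * second_moment nubar.
Proof.
rewrite ge0_integral_pushforward//; first last.
- by move=> s _; rewrite lee_fin sqnorm_ge0.
- exact: measurable_funS msqnormE.
- exact: measurable_Omega.
- exact: measurable_diag.
have -> : @diag R d @^-1` Omega d = Omega1.
  by apply/seteqP; split => r /= /diag_Omega.
rewrite /second_moment -ge0_integralZl//; first last.
- by move=> r _; rewrite lee_fin sqr_ge0.
- exact: measurable_Omega1.
apply: eq_integral => r _ /=; rewrite -EFinM /sqnorm; congr EFin.
under eq_bigr do rewrite tnth_diag.
by rewrite sumr_const card_ord mulr_natl.
Qed.

(** Pairs projected to the origin carry unconstrained mass, but [sqnorm] vanishes on their
    projection. *)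
Lemma integral_marginal
    (gamma : {measure set (d.-tuple R * d.-tuple R)%type -> \bar R})
    (proj : d.-tuple R * d.-tuple R -> d.-tuple R)
    (nu1 : {measure set (d.-tuple R) -> \bar R}) :
  measurable_fun setT proj -> (forall p, Omega2 d p -> orthant d (proj p)) ->
  gamma (~` Omega2 d) = 0 -> eq_on (Omega d) (pushforward gamma proj) nu1 ->
  \int[gamma]_(p in Omega2 d) (sqnorm (proj p))%:E =
  \int[nu1]_(s in Omega d) (sqnorm s)%:E.
Proof.
move=> mproj oproj g0 gnu.
have mE : measurable (proj @^-1` Omega d).
  rewrite -[X in measurable X]setTI; apply: mproj => //.
  exact: measurable_Omega.
rewrite (integral_support gamma _ _ _ measurable_Omega2 mE)//.
- pose m := pushforward_measure gamma proj mproj.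
  rewrite [RHS](eq_measure_integral m); last first.
    by move=> A mA AO; rewrite -gnu.
  rewrite [RHS]ge0_integral_pushforward//; first last.
  + by move=> s _; rewrite lee_fin sqnorm_ge0.
  + exact: measurable_funS msqnormE.
  + exact: measurable_Omega.
- exact: (measurableT_comp msqnormE mproj).
- by move=> p; rewrite lee_fin sqnorm_ge0.
move=> p /oproj op; rewrite /= OmegaE => /not_andP[//|/= /negP].
by rewrite lt_def sqnorm_ge0 andbT negbK => /eqP ->.
Qed.

End marginals.

(** * Double integrals over the quadrant and the overlap of two tails *)

Section overlap.
Context {R : realType}.

Definition layers (F : R -> R -> \bar R) : \bar R :=
  \int[lebesgue_measure]_(y in `]0%R, +oo[)
    \int[lebesgue_measure]_(x in `]0%R, +oo[) F x y.

(** Monotonicity in each variable is how measurability is obtained: the sections of [F] are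
    nonincreasing, and so is the inner integral as a function of [y]. *)
Definition antitone_layers (F : R -> R -> \bar R) :=
  [/\ forall x y, 0 <= F x y,
      forall y, {homo F^~ y : x x' / (x <= x')%R >-> x' <= x} &
      forall x, {homo F x : y y' / (y <= y')%R >-> y' <= y}].

Lemma eq_layers (F G : R -> R -> \bar R) :
  (forall x y, (0 < x)%R -> (0 < y)%R -> F x y = G x y) ->
  layers F = layers G.
Proof.
move=> FG; apply: eq_integral => y /set_mem/=; rewrite in_itv/= andbT => y0.
apply: eq_integral => x /set_mem/=; rewrite in_itv/= andbT => x0.
exact: FG.
Qed.

Lemma le_layers (F G : R -> R -> \bar R) :
  antitone_layers F -> antitone_layers G ->
  (forall x y, (0 < x)%R -> (0 < y)%R -> F x y <= G x y) ->
  layers F <= layers G.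
Proof.
move=> [F0 Fx Fy] [G0 Gx Gy] FG.
have meas (f : R -> \bar R) (A : set (measurableTypeR R)) :
    {homo f : x y / (x <= y)%R >-> y <= x} ->
    measurable_fun A (f : measurableTypeR R -> \bar R).
  move=> fxy; apply: (@measurable_funS _ _ _ _ setT) => //.
  exact: (nonincreasing_emeasurable _ fxy).
have pos (y : measurableTypeR R) : `]0%R, +oo[%classic y -> (0 < y)%R.
  by rewrite /= in_itv/= andbT.
have meas2 (H : R -> R -> \bar R) : antitone_layers H ->
    measurable_fun (`]0%R, +oo[%classic : set (measurableTypeR R))
      (fun y : measurableTypeR R =>
      \int[lebesgue_measure]_(x in `]0%R, +oo[) H x y).
  move=> [H0 Hx Hy].
  apply: (meas (fun y => \int[lebesgue_measure]_(x in `]0%R, +oo[) H x y)).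
  move=> y y' yy'; apply: ge0_le_integral => //.
  - by apply: (meas (fun x => H x y')) => x x'; exact: Hx.
  - by apply: (meas (fun x => H x y)) => x x'; exact: Hx.
  - by move=> x _; exact: Hy.
apply: ge0_le_integral => //.
- by move=> y _; exact: integral_ge0.
- exact: (meas2 F).
- exact: (meas2 G).
move=> y /pos y0; apply: ge0_le_integral => //.
- by apply: (meas (fun x => F x y)) => x x'; exact: Fx.
- by apply: (meas (fun x => G x y)) => x x'; exact: Gx.
- by move=> x /pos x0; exact: FG.
Qed.

(** The integral of the Fréchet-Hoeffding bound on the joint tail of a pair with marginals [P] and
    [Q]. *)
Definition overlap (P Q : {measure set R -> \bar R}) : \bar R :=
  layers (fun x y => mine (tail P x) (tail Q y)).

Lemma antitone_overlap (P Q : {measure set R -> \bar R}) :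
  antitone_layers (fun x y => mine (tail P x) (tail Q y)).
Proof.
split => [x y|y x x' xx'|x y y' yy'].
- by rewrite le_min !tail_ge0.
- by rewrite le_min !ge_min (le_tail P _ _ xx') lexx orbT.
- by rewrite le_min !ge_min (le_tail Q _ _ yy') lexx orbT.
Qed.

(** Layer cake under Lebesgue measure: by [lt_tail_inv] the layer at [(x, y)] is the interval of all
    positive [t] below both tails, whose length is their minimum. *)
Lemma integral_tail_inv (P Q : {measure set R -> \bar R}) :
  \int[lebesgue_measure]_(t in `]0%R, +oo[)
    (tail_inv P t%:E * tail_inv Q t%:E) = overlap P Q.
Proof.
have mt (S : {measure set R -> \bar R}) :
    measurable_fun (`]0%R, +oo[%classic : set (measurableTypeR R))
      (fun t : measurableTypeR R => tail_inv S t%:E).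
  apply: (@measurable_funS _ _ _ _ setT) => //.
  exact: (measurable_tail_inv S).
rewrite layer_cake//; first last.
- by move=> t _; exact: tail_inv_ge0.
- by move=> t _; exact: tail_inv_ge0.
- exact: sigma_finiteT.
apply: eq_layers => x y x0 y0; rewrite -[RHS]lebesgue_itv0; last first.
  by rewrite le_min !tail_ge0.
congr (lebesgue_measure _); apply/seteqP; split => t /=; rewrite in_itv/= andbT.
  move=> [t0 [xt yt]]; split => //.
  by rewrite lt_min -!lt_tail_inv ?ltW// xt yt.
move=> [t0]; rewrite lt_min => /andP[xt yt].
by rewrite !lt_tail_inv ?ltW.
Qed.

End overlap.

(** * The cost of a coupling with the diagonal measure *)

Section transport.
Context {R : realType} {d : nat}.
Hypothesis hd : (0 < d)%N.
Variable nu : {measure set (d.-tuple R) -> \bar R}.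
Hypothesis hnu : M2_Omega nu.
Variable nubar : {measure set R -> \bar R}.
Hypothesis hnubar : M2_Omega1 nubar.
Hypothesis hmarg : forall i : 'I_d,
  eq_on Omega1 (pushforward nu (fun s : d.-tuple R => tnth s i)) nubar.

Let i0 := Ordinal hd.
Let nuC := pushforward_measure nubar (@diag R d) measurable_diag.
Let TT := (d.-tuple R * d.-tuple R)%type.
Let M := second_moment nubar.

(** Under a coupling [p.2] is almost everywhere on the diagonal, and the coordinate [i0] reads off
    its common entry. *)
Definition cross (p : TT) : R := (coord_sum p.1 * tnth p.2 i0)%R.

Let mS1 : measurable_fun setT (fun p : TT => coord_sum p.1).
Proof. exact: (measurableT_comp measurable_coord_sum). Qed.

Let mT2 : measurable_fun setT (fun p : TT => tnth p.2 i0).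
Proof. exact: (measurableT_comp (measurable_tnth i0)). Qed.

Let mcross : measurable_fun setT (fun p => (cross p)%:E).
Proof. by apply/measurable_EFinP; exact: measurable_funM. Qed.

Let cross_ge0 p : Omega2 d p -> (0 <= cross p)%R.
Proof. by move=> [[h1 h2] _]; rewrite mulr_ge0// coord_sum_ge0. Qed.

Let msq : measurable_fun setT (fun s : d.-tuple R => (sqnorm s)%:E).
Proof. by apply/measurable_EFinP; exact: measurable_sqnorm. Qed.

Let msqd : measurable_fun setT (fun p : TT => (sqdist p)%:E).
Proof. by apply/measurable_EFinP; exact: measurable_sqdist. Qed.

Lemma second_moment_fin_num : second_moment nubar \is a fin_num.
Proof.
rewrite ge0_fin_numE; first by case: hnubar.
by apply: integral_ge0 => r _; rewrite lee_fin sqr_ge0.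
Qed.

Lemma coupling_identity (gamma : {measure set TT -> \bar R}) :
  extended_couplings nu (nu_co d nubar) gamma ->
  \int[gamma]_(p in Omega2 d) (sqdist p)%:E +
    2%:E * \int[gamma]_(p in Omega2 d) (cross p)%:E = (2 * d)%:R%:E * M.
Proof.
move=> [[g0 _] g1 g2].
have mO2 : measurable (@Omega2 R d) by exact: measurable_Omega2.
(* The points of [Omega d] off the diagonal, written through a measurable distance; [nu_co] does not
   charge them, hence no coupling has its second component there. *)
pose B : set (d.-tuple R) :=
  Omega d `&` (fun s => sqdist (s, diag (tnth s i0))) @^-1` [set~ 0%R].
have mB : measurable B.
  apply: measurableI; first exact: measurable_Omega.
  rewrite -[X in measurable X]setTI.
  apply: (measurableT_comp measurable_sqdist) => //; last first.
    by apply: measurableC; exact: measurable_set1.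
  apply: measurable_fun_pair => //.
  by apply: (measurableT_comp measurable_diag); exact: measurable_tnth.
have N0 : gamma (snd @^-1` B) = 0.
  have BO : B `<=` Omega d by move=> s [].
  have := g2 _ mB BO; rewrite /pushforward => ->.
  rewrite /nu_co /pushforward (_ : _ @^-1` B = set0) ?measure0//.
  apply/seteqP; split => // r [_] /= []; rewrite tnth_diag.
  by rewrite /sqdist big1// => i _; rewrite /= subrr expr0n.
have mN : measurable (snd @^-1` B : set TT).
  by rewrite -[X in measurable X]setTI; apply: measurable_snd.
rewrite -ge0_integralZl//; last exact: measurable_funS mcross.
rewrite -ge0_integralD//; first last.
- by apply: measurable_funeM; exact: measurable_funS mcross.
- by move=> p O2p; rewrite -EFinM lee_fin mulr_ge0// cross_ge0.
- exact: measurable_funS msqd.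
- by move=> p _; rewrite lee_fin sqdist_ge0.
transitivity (\int[gamma]_(p in Omega2 d) ((sqnorm p.1)%:E + (sqnorm p.2)%:E)).
  have m1 : measurable_fun setT (fun p : TT => (sqnorm p.1)%:E).
    exact: (measurableT_comp msq).
  have m2 : measurable_fun setT (fun p : TT => (sqnorm p.2)%:E).
    exact: (measurableT_comp msq).
  rewrite (ge0_negligible_integral mN)//; first last.
  - move=> p O2p; rewrite -EFinM -EFinD lee_fin addr_ge0// ?sqdist_ge0//.
    by rewrite mulr_ge0// cross_ge0.
  - apply: emeasurable_funD; first exact: measurable_funS msqd.
    by apply: measurable_funeM; exact: measurable_funS mcross.
  rewrite [RHS](ge0_negligible_integral mN)//; first last.
  - by move=> p _; rewrite -EFinD lee_fin addr_ge0// sqnorm_ge0.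
  - apply: emeasurable_funD; first exact: measurable_funS m1.
    exact: measurable_funS m2.
  apply: eq_integral => p /set_mem [[[h1 h2] _] nB].
  (* A second component outside [Omega d] can only be the origin, which is also on the diagonal. *)
  have pE : p.2 = diag (tnth p.2 i0).
    have [h|nO2] := pselect (Omega d p.2).
      by apply: sqdist_eq0; apply: contrapT => h0; apply: nB.
    have [->|n0] := eqVneq p.2 (origin d).
      by apply: eq_from_tnth => i; rewrite tnth_diag !tnth_mktuple.
    by exfalso; apply: nO2; split => //; exact/eqP.
  rewrite -EFinM -!EFinD; congr EFin.
  have := sqdist_diag p.1 (tnth p.2 i0); rewrite -pE.
  by case: p {h1 h2 nB pE} => s t /= ->.
rewrite ge0_integralD//; first last.
- apply: (@measurable_funS _ _ _ _ setT) => //.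
  exact: (measurableT_comp msq).
- by move=> p _; rewrite lee_fin sqnorm_ge0.
- apply: (@measurable_funS _ _ _ _ setT) => //.
  exact: (measurableT_comp msq).
- by move=> p _; rewrite lee_fin sqnorm_ge0.
rewrite (integral_marginal gamma fst nu)//; last by move=> p [[]].
rewrite (integral_marginal gamma snd nuC)//; last by move=> p [[]].
rewrite (integral_sqnorm nu hnu nubar hmarg) (integral_sqnorm_co hd nubar).
rewrite -/M -muleDl//; last exact: second_moment_fin_num.
by rewrite -EFinD -natrD addnn -mul2n.
Qed.

Lemma cross_layers (gamma : {measure set TT -> \bar R}) :
  M2_Omega2 gamma ->
  \int[gamma]_(p in Omega2 d) (cross p)%:E =
  layers (fun x y => gamma (Omega2 d `&`
    [set p | x%:E < (coord_sum p.1)%:E /\ y%:E < (tnth p.2 i0)%:E])).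
Proof.
move=> M2g.
have sg : sigma_finite setT gamma.
  apply: in_M2_sigma_finite M2g.
  - exact: measurable_Omega2.
  - by apply: (@measurable_funS _ _ _ _ setT) => //; exact: measurable_sqnorm2.
  - by move=> p; rewrite Omega2E => -[].
under eq_integral do rewrite /cross EFinM.
apply: layer_cake => //.
- exact: measurable_Omega2.
- by apply/measurable_EFinP; exact: (measurable_funS _ _ mS1).
- by apply/measurable_EFinP; exact: (measurable_funS _ _ mT2).
- by move=> p [[h1 _] _]; rewrite lee_fin coord_sum_ge0.
- by move=> p [[_ h2] _]; rewrite lee_fin.
Qed.

End transport.

(** * The optimal coupling *)

Section optimal.
Context {R : realType} {d : nat}.
Hypothesis hd : (0 < d)%N.
Variable nu : {measure set (d.-tuple R) -> \bar R}.
Hypothesis hnu : M2_Omega nu.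
Variable nubar : {measure set R -> \bar R}.
Hypothesis hnubar : M2_Omega1 nubar.
Hypothesis hmarg : forall i : 'I_d,
  eq_on Omega1 (pushforward nu (fun s : d.-tuple R => tnth s i)) nubar.

Let i0 := Ordinal hd.
Let P := pushforward_measure nu coord_sum measurable_coord_sum.
Let M2P : M2_Omega1 P := M2_nu_plus nu hnu.
Let nuC := pushforward_measure nubar (@diag R d) measurable_diag.
Let TT := (d.-tuple R * d.-tuple R)%type.
Let M := second_moment nubar.

Let super (x y : R) : set TT := Omega2 d `&`
  [set p | x%:E < (coord_sum p.1)%:E /\ y%:E < (tnth p.2 i0)%:E].

Let ray_preimage (f : d.-tuple R -> R) (x : R) : measurable_fun setT f ->
  measurable (Omega d `&` f @^-1` `]x, +oo[).
Proof.
move=> mf; apply: measurableI; first exact: measurable_Omega.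
by rewrite -[X in measurable X]setTI; apply: mf.
Qed.

Let msuper x y : measurable (super x y).
Proof.
have m1 : measurable_fun setT (fun p : TT => coord_sum p.1).
  exact: (measurableT_comp measurable_coord_sum).
have m2 : measurable_fun setT (fun p : TT => tnth p.2 i0).
  exact: (measurableT_comp (measurable_tnth i0)).
apply: measurableI; first exact: measurable_Omega2.
rewrite (_ : mkset _ = (fun p : TT => coord_sum p.1) @^-1` `]x, +oo[ `&`
                       (fun p : TT => tnth p.2 i0) @^-1` `]y, +oo[).
  by apply: measurableI; rewrite -[X in measurable X]setTI;
    [apply: m1|apply: m2].
by apply/seteqP; split => p /=; rewrite !in_itv/= !andbT !lte_fin.
Qed.

(** Each joint tail is at most either marginal tail. Positive levels [x] and [y] force both
    components into [Omega d], the only place where the marginals of [gamma] are prescribed. *)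
Lemma cross_le_overlap (gamma : {measure set TT -> \bar R}) :
  extended_couplings nu (nu_co d nubar) gamma ->
  \int[gamma]_(p in Omega2 d) (cross hd p)%:E <= overlap P nubar.
Proof.
move=> [M2g g1 g2]; rewrite cross_layers//; apply: le_layers.
- split => [x y|y x x' xx'|x y y' yy'].
  + exact: measure_ge0.
  + apply: le_measure; rewrite ?inE; [exact: msuper|exact: msuper|].
    move=> p [Op /=]; rewrite !lte_fin => -[px py]; split => //=.
    by rewrite ?lte_fin; split => //; exact: le_lt_trans xx' px.
  + apply: le_measure; rewrite ?inE; [exact: msuper|exact: msuper|].
    move=> p [Op /=]; rewrite !lte_fin => -[px py]; split => //=.
    by rewrite ?lte_fin; split => //; exact: le_lt_trans yy' py.
- exact: antitone_overlap.
move=> x y x0 y0; rewrite le_min; apply/andP; split.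
  have mA := ray_preimage coord_sum x measurable_coord_sum.
  apply: (@le_trans _ _
    (gamma (fst @^-1` (Omega d `&` coord_sum @^-1` `]x, +oo[)))).
    apply: le_measure; rewrite ?inE; first exact: msuper.
      by rewrite -[X in measurable X]setTI; apply: measurable_fst.
    move=> p [[[h1 h2] _] /=]; rewrite lte_fin => -[px _]; split.
      by rewrite OmegaE; split => //=; rewrite -coord_sum_gt0// (lt_trans x0).
    by rewrite /= in_itv/= andbT.
  have := g1 _ mA (@subIsetl _ _ _); rewrite /pushforward => ->.
  apply: (@le_measure _ _ _ nu); rewrite ?inE//.
    by rewrite -[X in measurable X]setTI; apply: measurable_coord_sum.
have mA := ray_preimage (fun s => tnth s i0) y (measurable_tnth i0).
apply: (@le_trans _ _ (gamma (snd @^-1` (Omega d `&`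
    (fun s : d.-tuple R => tnth s i0) @^-1` `]y, +oo[)))).
  apply: le_measure; rewrite ?inE; first exact: msuper.
    by rewrite -[X in measurable X]setTI; apply: measurable_snd.
  move=> p [[[h1 h2] _] /=]; rewrite !lte_fin => -[_ py]; split.
    rewrite OmegaE; split => //=; rewrite -coord_sum_gt0// (lt_trans y0)//.
    by rewrite (lt_le_trans py)// tnth_le_coord_sum.
  by rewrite /= in_itv/= andbT.
have := g2 _ mA (@subIsetl _ _ _); rewrite /pushforward => ->.
apply: (@le_measure _ _ _ nubar); rewrite ?inE.
- by rewrite -[X in measurable X]setTI; apply: measurable_diag.
- exact: measurable_itv.
move=> r [_ /=]; rewrite !in_itv/= !andbT.
by rewrite -/(diag r) tnth_diag.
Qed.

(** A single coordinate is at most the sum. This is the hypothesis [QP] of the monotone coupling,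
    and the reason why [nu] has enough mass to cover [nubar]. *)
Lemma tail_marginal_le (y : R) : (0 < y)%R -> tail nubar y <= tail P 0.
Proof.
move=> y0; have yO : `]y, +oo[%classic `<=` (@Omega1 R).
  by move=> z; rewrite /Omega1/= !in_itv/= !andbT; exact: lt_trans.
have mray : measurable (`]y, +oo[%classic : set R) by exact: measurable_itv.
rewrite [leLHS]/tail -(hmarg i0 _ mray yO).
have mi : measurable ((fun s : d.-tuple R => tnth s i0) @^-1` `]y, +oo[).
  by rewrite -[X in measurable X]setTI; apply: measurable_tnth.
have nO : nu (~` Omega d) = 0 by case: hnu.
rewrite /pushforward -(measure_setD_null nu _ (~` Omega d))//; last first.
  by apply: measurableC; exact: measurable_Omega.
apply: (@le_measure _ _ _ nu); rewrite ?inE.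
- by apply: measurableD => //; apply: measurableC; exact: measurable_Omega.
- by rewrite -[X in measurable X]setTI; apply: measurable_coord_sum.
move=> s [/=]; rewrite !in_itv/= !andbT => ys /contrapT [os _].
by rewrite (lt_trans y0)// (lt_le_trans ys)// tnth_le_coord_sum.
Qed.

Let qt := quantile nu (@coord_sum R d) measurable_coord_sum nubar.
Let mqt : measurable_fun setT qt :=
  measurable_quantile nu _ measurable_coord_sum nubar.
Let mD := measurable_transform_domain (@coord_sum R d) measurable_coord_sum.
Let mm := mrestr (extended_measure nu) mD.
Let h (p : d.-tuple R * measurableTypeR R) : TT := (p.1, diag (qt p)).

Let mh : measurable_fun setT h.
Proof.
apply: measurable_fun_pair => //.
exact: (measurableT_comp measurable_diag mqt).
Qed.

Definition optimal_coupling : {measure set TT -> \bar R} :=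
  pushforward_measure mm h mh.

Let domain_Omega (A : set (d.-tuple R)) : measurable A -> A `<=` Omega d ->
  fst @^-1` A `&` transform_domain coord_sum = A `*` `[0%R, 1%R]%classic.
Proof.
move=> mA AO; apply/seteqP; split => -[s u] [/=].
  by move=> As [_ /= u01]; split => //=; rewrite in_itv.
rewrite in_itv/= => As u01; split => //; split => //=.
by have := AO _ As; rewrite OmegaE => -[os /=]; rewrite coord_sum_gt0.
Qed.

Let optimal_fst : eq_on (Omega d) (pushforward optimal_coupling fst) nu.
Proof.
move=> A mA AO; rewrite /pushforward /optimal_coupling /=.
rewrite /pushforward_measure/= /pushforward /mm /mrestr /=.
rewrite (_ : _ `&` _ = A `*` `[0%R, 1%R]%classic); last first.
  by rewrite -domain_Omega.
rewrite /extended_measure product_measure1E// -[RHS]mule1; congr (_ * _).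
exact: lebesgue_unit_itv.
Qed.

Let optimal_snd :
  eq_on (Omega d) (pushforward optimal_coupling snd) (nu_co d nubar).
Proof.
move=> A mA AO; rewrite /nu_co [RHS]/pushforward.
rewrite -(quantile_law nu _ measurable_coord_sum nubar M2P hnubar
  tail_marginal_le).
- by [].
- by rewrite -[X in measurable X]setTI; apply: measurable_diag.
- by move=> r /= /AO/(diag_Omega hd).
Qed.

Let off_Omega : set (d.-tuple R * measurableTypeR R) := (~` Omega d) `*` setT.

Let moff : measurable off_Omega.
Proof.
by apply: measurableX => //; apply: measurableC; exact: measurable_Omega.
Qed.

Let null_rect : extended_measure nu off_Omega = 0.
Proof.
(* The second factor is infinite; the product is 0 by the convention [0 * +oo = 0]. *)
transitivity (nu (~` Omega d) * lebesgue_measure [set: R]).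
  apply: product_measure1E => //; apply: measurableC.
  exact: measurable_Omega.
by case: hnu => nO _; rewrite [X in X * _]nO mul0e.
Qed.

Let optimal_null : optimal_coupling (~` Omega2 d) = 0.
Proof.
rewrite /optimal_coupling /pushforward_measure/= /pushforward /mm /mrestr.
apply/eqP; rewrite eq_le measure_ge0 andbT.
rewrite -null_rect.
apply: le_measure; rewrite ?inE.
- apply: measurableI => //; rewrite -[X in measurable X]setTI.
  by apply: mh => //; apply: measurableC; exact: measurable_Omega2.
- exact: moff.
move=> -[s u] [/= nO2 _]; split => //= -[os so]; apply: nO2; split.
  split => //= i; rewrite tnth_diag; exact: quantile_ge0.
by move=> [so' _]; exact: so.
Qed.

Lemma optimal_couplingP :
  extended_couplings nu (nu_co d nubar) optimal_coupling.
Proof.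
split; [|exact: optimal_fst|exact: optimal_snd].
split; first exact: optimal_null.
have msq : measurable_fun setT (fun s : d.-tuple R => (sqnorm s)%:E).
  by apply/measurable_EFinP; exact: measurable_sqnorm.
under eq_integral do rewrite /sqnorm2 EFinD.
rewrite ge0_integralD//; first last.
- apply: (@measurable_funS _ _ _ _ setT) => //.
  exact: (measurableT_comp msq).
- by move=> p _; rewrite lee_fin sqnorm_ge0.
- apply: (@measurable_funS _ _ _ _ setT) => //.
  exact: (measurableT_comp msq).
- by move=> p _; rewrite lee_fin sqnorm_ge0.
- exact: measurable_Omega2.
rewrite (integral_marginal optimal_coupling fst nu)//; last by move=> p [[]].
rewrite (integral_marginal optimal_coupling snd nuC)//; last by move=> p [[]].
rewrite (integral_sqnorm nu hnu nubar hmarg) (integral_sqnorm_co hd nubar).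
have /fineK <- := second_moment_fin_num nubar hnubar.
by rewrite -!EFinM -EFinD ltry.
Qed.

Lemma cross_optimal :
  \int[optimal_coupling]_(p in Omega2 d) (cross hd p)%:E = overlap P nubar.
Proof.
have [M2o _ _] := optimal_couplingP.
rewrite cross_layers//; apply: eq_layers => x y x0 y0.
rewrite -(quantile_joint_law nu _ measurable_coord_sum nubar M2P hnubar
  tail_marginal_le)//.
rewrite /optimal_coupling /pushforward_measure/= /pushforward /mm /mrestr.
have mDx : measurable (transform_domain coord_sum `&`
    [set p : d.-tuple R * measurableTypeR R | (x < coord_sum p.1)%R]).
  apply: measurableI => //.
  rewrite (_ : mkset _ = (coord_sum \o fst) @^-1` `]x, +oo[%classic).
    rewrite -[X in measurable X]setTI.
    by apply: (measurableT_comp measurable_coord_sum measurable_fst).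
  by apply/seteqP; split => p /=; rewrite in_itv/= andbT.
(* The two events agree only over [Omega d], so the null rectangle is removed from both. *)
rewrite -[LHS](measure_setD_null _ _ _ _ moff null_rect); last first.
  apply: measurableI => //; rewrite -[X in measurable X]setTI.
  by apply: mh => //; exact: msuper.
rewrite -[RHS](measure_setD_null _ _ _ _ moff null_rect); last first.
  by apply: measurableI => //; exact: measurable_quantile_gt.
congr (extended_measure nu _); apply/seteqP; split => -[s u] [].
  rewrite /= !lte_fin tnth_diag => -[[_ [xs yq]] Ds] nO.
  by split => //; split => //; split.
move=> [[Ds /= xs] yq] nO; split => //; split => //.
have /contrapT [os so] : ~ ~ Omega d s by move=> nOs; apply: nO.
split; last by rewrite /= !lte_fin tnth_diag.
split; last by move=> [].
by split => //= i; rewrite tnth_diag; exact: quantile_ge0.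
Qed.

Lemma wasserstein_co :
  wasserstein nu (nu_co d nubar) ^+ 2 =
  (2 * d)%:R%:E * M - 2%:E * overlap P nubar.
Proof.
rewrite /wasserstein.
set S := [set _ | _ in _].
have S0 v : S v -> 0 <= v.
  by move=> [g _ <-]; apply: integral_ge0 => p _; rewrite lee_fin sqdist_ge0.
rewrite sqr_sqrte; last by apply: le_ereal_inf_tmp.
have Mfin : (2 * d)%:R%:E * M \is a fin_num.
  by rewrite fin_numM// second_moment_fin_num.
have C0 (g : {measure set TT -> \bar R}) :
    0 <= \int[g]_(p in Omega2 d) (cross hd p)%:E.
  apply: integral_ge0 => p [[h1 h2] _].
  by rewrite lee_fin mulr_ge0// coord_sum_ge0.
have E0 (g : {measure set TT -> \bar R}) :
    0 <= \int[g]_(p in Omega2 d) (sqdist p)%:E.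
  by apply: integral_ge0 => p _; rewrite lee_fin sqdist_ge0.
have valE (g : {measure set TT -> \bar R}) :
    extended_couplings nu (nu_co d nubar) g ->
    \int[g]_(p in Omega2 d) (sqdist p)%:E = (2 * d)%:R%:E * M -
      2%:E * \int[g]_(p in Omega2 d) (cross hd p)%:E.
  move=> cg; have id := coupling_identity hd nu hnu nubar hnubar hmarg _ cg.
  rewrite -id addeK//.
  (* [addeK] leaves the finiteness of the cross term, which is bounded by the finite total. *)
  have : 2%:E * \int[g]_(p in Omega2 d) (cross hd p)%:E <= (2 * d)%:R%:E * M.
    by rewrite -id leeDr.
  move=> H; rewrite ge0_fin_numE ?mule_ge0//; apply: (le_lt_trans H).
  by rewrite -ge0_fin_numE// (le_trans _ H)// mule_ge0.
apply/eqP; rewrite eq_le; apply/andP; split.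
  rewrite -cross_optimal -valE; last exact: optimal_couplingP.
  apply: ereal_inf_lbound; exists optimal_coupling => //.
  exact: optimal_couplingP.
apply: le_ereal_inf_tmp => _ [g cg <-]; rewrite valE// leeB// lee_pmul2l//.
exact: cross_le_overlap.
Qed.

End optimal.

(** * The atomless case *)

Section atomless.
Context {R : realType}.
Variables P Q : {measure set R -> \bar R}.
Hypotheses (M2P : M2_Omega1 P) (M2Q : M2_Omega1 Q).
Hypothesis atomlessP : forall s, (0 < s)%R -> P [set s] = 0.
Hypothesis QP : forall y, (0 < y)%R -> tail Q y <= tail P 0.

Let mid : measurable_fun setT (@id R) := @measurable_id _ _ setT.

Lemma measurable_tail_inv_tail :
  measurable_fun setT (fun s => tail_inv Q (tail P s)).
Proof.
(* The composite of two nonincreasing maps is nondecreasing; the reflection makes the lemma for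
   nonincreasing maps apply. *)
rewrite (_ : (fun _ => _) = (fun s => tail_inv Q (tail P (- s)%R)) \o -%R).
  apply: measurableT_comp => //; apply: nonincreasing_emeasurable => x y xy.
  by apply: le_tail_inv; apply: le_tail; rewrite lerN2.
by apply/funext => s /=; rewrite opprK.
Qed.

(** Take [X = id]. Without atoms the closed and open tails agree, so [V (s, u)] is the tail of [P]
    at [s], and [y < tail_inv Q (tail P s)] says that [V] is below [tail Q y]. Each layer is then an
    event of [transform_joint_law], of mass the minimum of the tails. *)
Lemma integral_tail_inv_tail :
  \int[P]_(s in Omega1) (s%:E * tail_inv Q (tail P s)) = overlap P Q.
Proof.
rewrite layer_cake//; first last.
- by move=> s _; exact: tail_inv_ge0.
- by move=> s; rewrite /Omega1/= in_itv/= andbT lee_fin => /ltW.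
- exact: measurable_funS measurable_tail_inv_tail.
- exact: measurable_Omega1.
- exact: M2_Omega1_sigma_finite.
apply: eq_layers => x y x0 y0.
have tyE : tail Q y = (fine (tail Q y))%:E.
  by rewrite fineK// ge0_fin_numE ?tail_ge0// tail_lty.
rewrite [in RHS]tyE -(transform_joint_law P id mid M2P)//; last 2 first.
- by rewrite fine_ge0// tail_ge0.
- by rewrite -tyE; exact: QP.
pose A : set R :=
  Omega1 `&` [set t | x%:E < t%:E /\ y%:E < tail_inv Q (tail P t)].
have mA : measurable A.
  rewrite (_ : A = Omega1 `&` `]x, +oo[ `&`
      (setT `&` [set t | y%:E < tail_inv Q (tail P t)])).
    apply: measurableI; last first.
      by apply: measurable_lte => //; exact: measurable_tail_inv_tail.
    by apply: measurableI => //; exact: measurable_Omega1.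
  rewrite setTI; apply/seteqP; split => t; rewrite /A/= in_itv/= andbT lte_fin.
    by move=> [? []].
  by move=> [[]].
have -> : transform_domain id `&` [set p | (x < p.1)%R] `&`
    [set p | (transform P id mid p < fine (tail Q y))%R] =
    A `*` `[0%R, 1%R]%classic.
  have VE (s u : R) : (0 < s)%R -> transform P id mid (s, u) = fine (tail P s).
    move=> s0; transitivity (fine (tail P s) +
      u * (fine (closed_tail P s) - fine (tail P s)))%R => //.
    by rewrite closed_tailE atomlessP// adde0 subrr mulr0 addr0.
  have lt_tail s : (0 < s)%R ->
      (y%:E < tail_inv Q (tail P s)) = (fine (tail P s) < fine (tail Q y))%R.
    move=> s0; rewrite lt_tail_inv ?ltW// -[RHS]lte_fin -tyE fineK//.
    by rewrite ge0_fin_numE ?tail_ge0// tail_lty.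
  apply/seteqP; split => -[s u].
    move=> [[[/= s0 u01] xs]]; rewrite /= VE// -lt_tail// => ys.
    by split; rewrite /= ?in_itv//=; split => //;
      rewrite /Omega1/= in_itv/= andbT.
  rewrite /= in_itv/= => -[[]].
  rewrite /Omega1/= in_itv/= andbT => s0 [xs ys] u01.
  split; last by rewrite /= VE// -lt_tail.
  by split => //; split.
rewrite /extended_measure -[LHS]mule1 -/A.
rewrite -[in LHS]lebesgue_unit_itv; apply/esym; apply: product_measure1E => //.
Qed.

End atomless.

(** * The measure concentrated on the axes *)

Section perp.
Context {R : realType} {d : nat}.
Variable nu : {measure set (d.-tuple R) -> \bar R}.
Hypothesis hnu : M2_Omega nu.
Variable nubar : {measure set R -> \bar R}.
Hypothesis hperp : eq_on (Omega d) nu (nu_perp d nubar).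

Let P := pushforward_measure nu coord_sum measurable_coord_sum.

(** Each axis embedding is a right inverse of the coordinate sum, so each of the [d] pieces of
    [nu_perp] is sent back to [nubar]. The set is first cut down to [Omega d], where [hperp]
    holds. *)
Lemma nu_plus_perp (A : set R) : measurable A -> A `<=` Omega1 ->
  P A = d%:R%:E * nubar A.
Proof.
move=> mA A0.
have mSA : measurable (coord_sum @^-1` A : set (d.-tuple R)).
  by rewrite -[X in measurable X]setTI; apply: measurable_coord_sum.
have nO : nu (~` Omega d) = 0 by case: hnu.
transitivity (nu (coord_sum @^-1` A `\` ~` Omega d)).
  rewrite measure_setD_null//.
  by apply: measurableC; exact: measurable_Omega.
rewrite hperp; first last.
- by move=> s [_ /contrapT].
- by apply: measurableD => //; apply: measurableC; exact: measurable_Omega.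
rewrite /nu_perp (eq_bigr (fun=> nubar A)) => [|j _].
  by rewrite [RHS]mule_natl sumr_const card_ord.
rewrite /pushforward; congr (nubar _).
set axis := fun s : R => [tuple (if i == j then s else 0%R) | i < d].
have axisE s i : tnth (axis s) i = if i == j then s else 0%R.
  by rewrite tnth_mktuple.
have sumE s : coord_sum (axis s) = s.
  rewrite /coord_sum (bigD1 j)//= axisE eqxx big1 ?addr0// => i ij.
  by rewrite axisE (negbTE ij).
apply/seteqP; split => [s [/=]|s As]; first by rewrite sumE.
split; rewrite /= ?sumE// => nOs; apply: nOs.
have s0 : (0 < s)%R by have := A0 _ As; rewrite /Omega1/= in_itv/= andbT.
have os : orthant d (axis s).
  by move=> i; rewrite axisE; case: ifP => // _; exact: ltW.
by rewrite OmegaE; split => //=; rewrite -coord_sum_gt0// sumE.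
Qed.

(** Admissible couplings see their marginals only on subsets of [Omega d]. *)
Lemma wasserstein_perp (nu2 : set (d.-tuple R) -> \bar R) :
  wasserstein (nu_perp d nubar) nu2 = wasserstein nu nu2.
Proof.
rewrite /wasserstein; congr (sqrte (ereal_inf (_ @` _))).
apply/seteqP; split => g [M2g g1 g2]; split => // A mA AO.
  by rewrite g1// hperp.
by rewrite g1// -hperp.
Qed.

End perp.

(** The second formula is claimed for atomless [nubar], and it fails with atoms: for [d = 2] and
    [nubar] the Dirac mass at 1, its right-hand side is 0. The squared distance is 2: one axis point
    moves to (1, 1), the other to the origin, each at cost 1. *)
Theorem theorem5 (R : realType) (d : nat) (hd : (0 < d)%N)
  (nu : {measure set (d.-tuple R) -> \bar R}) (hnu : M2_Omega nu)
  (nubar : {measure set R -> \bar R}) (hnubar : M2_Omega1 nubar)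
  (hmarg : forall i : 'I_d,
    eq_on Omega1 (pushforward nu (fun s : d.-tuple R => tnth s i)) nubar) :
  [/\ M2_Omega1 (nu_plus nu),
      wasserstein nu (nu_co d nubar) ^+ 2 =
        (2 * d)%:R%:E * second_moment nubar
        - 2%:E * \int[lebesgue_measure]_(t in `]0%R, +oo[)
                   (tail_inv (nu_plus nu) t%:E * tail_inv nubar t%:E)
    & eq_on (Omega d) nu (nu_perp d nubar) ->
      (forall x : R, nubar [set x] = 0) ->
      wasserstein (nu_perp d nubar) (nu_co d nubar) ^+ 2 =
        (2 * d)%:R%:E *
        (second_moment nubar
         - \int[nubar]_(s in Omega1)
             (s%:E * tail_inv nubar (d%:R%:E * tail nubar s)))].
Proof.
have M2P := M2_nu_plus nu hnu.
have WE := wasserstein_co hd nu hnu nubar hnubar hmarg.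
set P := pushforward_measure nu coord_sum measurable_coord_sum in M2P WE.
split => // [|hperp atomless].
  by rewrite WE -integral_tail_inv.
have PE := nu_plus_perp nu hnu nubar hperp.
have PtE s : (0 < s)%R -> tail P s = d%:R%:E * tail nubar s.
  move=> s0; rewrite /tail PE// => r; rewrite /Omega1/= !in_itv/= !andbT.
  exact: lt_trans.
rewrite (wasserstein_perp nu nubar hperp) WE.
set K := \int[nubar]_(s in Omega1) _.
have K0 : 0 <= K.
  apply: integral_ge0 => s; rewrite /Omega1/= in_itv/= andbT => s0.
  by rewrite mule_ge0 ?tail_inv_ge0// lee_fin ltW.
(* The overlap is an integral against [P], which is [d] times [nubar] on [Omega1]; this gives both
   the outer factor [d] and the argument [d * U] of the inverse. *)
have -> : overlap P nubar = d%:R%:E * K.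
  rewrite -(integral_tail_inv_tail P nubar M2P hnubar); first last.
  - exact: (tail_marginal_le hd nu hnu nubar hmarg).
  - move=> s s0; rewrite PE//; first by rewrite atomless mule0.
    by move=> r ->; rewrite /Omega1/= in_itv/= s0.
  rewrite (eq_measure_integral (mscale (NngNum (ler0n R d)) nubar)); last first.
    exact: PE.
  rewrite ge0_integral_mscale//; first last.
  - move=> s; rewrite /Omega1/= in_itv/= andbT => s0.
    by rewrite mule_ge0 ?tail_inv_ge0// lee_fin ltW.
  - apply: emeasurable_funM; first exact: EFin_measurable.
    apply: (@measurable_funS _ _ _ _ setT) => //.
    exact: measurable_tail_inv_tail.
  - exact: measurable_Omega1.
  congr (_ * _); apply: eq_integral => s /set_mem.
  by rewrite /Omega1/= in_itv/= andbT => s0; rewrite PtE.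
have Mfin := second_moment_fin_num nubar hnubar.
move: (second_moment nubar) K Mfin K0 => {WE} M K Mfin K0.
rewrite muleBr//; last exact: fin_num_adde_defr.
by rewrite natrM EFinM -!muleA.
Qed.
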